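(* Let $\mathcal{G}^{(s)}=\{u\in\mathcal{F}_\mathrm{e}: \mathcal{E}(u,v)=0\text{ for all }v\in\mathcal{F}^{(s)}_\mathrm{e}\}$. Then $$\mathcal{G}^{(s)}=\{u\in\mathcal{F}_\mathrm{e}: u'\text{ is a.e. equal to a constant on }G\}.$$ If $m(G)=\infty$ (equivalently, $s(-\infty)=-\infty$ or $s(\infty)=\infty$), then $\mathcal{G}^{(s)}=\{u\in\mathcal{F}_\mathrm{e}:u'=0\text{ a.e. on }G\}$. Moreover, every $u\in\mathcal{F}_\mathrm{e}$ can be written as $u=u_1+u_2$ with $u_1\in\mathcal{F}^{(s)}_\mathrm{e}$ and $u_2\in\mathcal{G}^{(s)}$. This decomposition is unique if $(\mathcal{E}^{(s)},\mathcal{F}^{(s)})$ is transient (i.e. $s(-\infty)>-\infty$ or $s(\infty)<\infty$). It is unique up to an additive constant if $(\mathcal{E}^{(s)},\mathcal{F}^{(s)})$ is recurrent (i.e. $s(-\infty)=-\infty$ and $s(\infty)=\infty$).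
   Context: Let $m$ be Lebesgue measure. $(\mathcal{E},\mathcal{F})=(\frac12\mathbf{D},H^1(\mathbf{R}))$, $\mathcal{E}(u,v)=\frac12\int u'v'dx$, with extended space $\mathcal{F}_\mathrm{e}=\{u\text{ absolutely continuous},\ u'\in L^2(\mathbf{R})\}$, on which $\mathcal{E}$ is defined by the same formula. Let $s$ be strictly increasing, absolutely continuous, with $s'\in\{0,1\}$ a.e. Let $(\mathcal{E}^{(s)},\mathcal{F}^{(s)})$ be given by $\mathcal{F}^{(s)}=\{u\in L^2:u\ll s,\int(du/ds)^2ds<\infty\}$ and $\mathcal{E}^{(s)}(u,v)=\frac12\int\frac{du}{ds}\frac{dv}{ds}ds$, with extended space $\mathcal{F}^{(s)}_\mathrm{e}=\{u\ll s:\int(du/ds)^2ds<\infty,\ u(\infty)=0\text{ if }s(\infty)<\infty,\ u(-\infty)=0\text{ if }s(-\infty)>-\infty\}$. Let $G=\{s'=1\}$, $F=\mathbf{R}\setminus G$, and assume $G$ is open, $m(F)>0$ and $F$ has no isolated points. *)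

(* Defs.v *)
From HB Require Import structures.
From mathcomp Require Import all_boot all_order all_algebra.
From mathcomp Require Import all_classical all_reals all_analysis.
Set Implicit Arguments. Unset Strict Implicit. Unset Printing Implicit Defensive.
Import Order.TTheory GRing.Theory Num.Theory.
Import numFieldNormedType.Exports.
Local Open Scope classical_set_scope.
Local Open Scope ring_scope.

Section defs.
Context {R : realType}.

Local Notation m := (@lebesgue_measure R).

Definition abs_cont_wrt (s u : R -> R) : Prop :=
  forall a b : R, a <= b -> forall eps : R, 0 < eps ->
  exists delta : R, 0 < delta /\
    forall (n : nat) (x y : 'I_n -> R),
      (forall i, a <= x i /\ x i <= y i /\ y i <= b) ->
      (forall i j, i != j -> y i <= x j \/ y j <= x i) ->
      \sum_(i < n) `|s (y i) - s (x i)| < delta ->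
      \sum_(i < n) `|u (y i) - u (x i)| < eps.

Definition abs_continuous (u : R -> R) : Prop := abs_cont_wrt idfun u.

(* the derivative u' (defined where u is differentiable, 0 elsewhere;
   for absolutely continuous u this is an a.e. defined representative) *)
Definition dderiv (u : R -> R) (x : R) : R :=
  if `[< derivable u x 1 >] then derive1 u x else 0.

(* extended Dirichlet space of (1/2 D, H^1(R)) *)
Definition Fe (u : R -> R) : Prop :=
  abs_continuous u /\ measurable_fun setT (dderiv u) /\
  (\int[m]_x ((dderiv u x) ^+ 2)%:E < +oo)%E.

Definition Eform (u v : R -> R) : \bar R :=
  ((2^-1)%:E * \int[m]_x (dderiv u x * dderiv v x)%:E)%E.

(* the Lebesgue-Stieltjes measure ds of s (s nondecreasing, right continuous;
   the zero measure otherwise, a case that never occurs below) *)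
Definition ds (s : R -> R) : {measure set (measurableTypeR R) -> \bar R} :=
  match pselect ({homo s : x y / x <= y} /\
                 (forall x, s @ at_right x --> s x)) with
  | left H =>
      lebesgue_stieltjes_measure
        (HB.pack s (isCumulative.Build R _ R s (proj1 H) (proj2 H)))
  | right _ => mzero
  end.

Definition dds (s u f : R -> R) : Prop :=
  measurable_fun setT f /\
  forall x y : R, x < y ->
    (ds s).-integrable `]x, y] (EFin \o f) /\
    ((u y - u x)%:E = \int[ds s]_(t in `]x, y]) (f t)%:E)%E.

Definition s_top_inf (s : R -> R) : Prop := s x @[x --> +oo] --> +oo.
Definition s_bot_inf (s : R -> R) : Prop := s x @[x --> -oo] --> -oo.

Definition Fs_e (s u : R -> R) : Prop :=
  abs_cont_wrt s u /\
  (exists f : R -> R, dds s u f /\ (\int[ds s]_x ((f x) ^+ 2)%:E < +oo)%E) /\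
  (~ s_top_inf s -> u x @[x --> +oo] --> (0 : R)) /\
  (~ s_bot_inf s -> u x @[x --> -oo] --> (0 : R)).

Definition Gs (s u : R -> R) : Prop :=
  Fe u /\ forall v, Fs_e s v -> Eform u v = 0%E.

Definition s_transient (s : R -> R) : Prop := ~ s_bot_inf s \/ ~ s_top_inf s.
Definition s_recurrent (s : R -> R) : Prop := s_bot_inf s /\ s_top_inf s.

End defs.

(* Main.v *)
(** Since [G] is open and [s' = 1_G] a.e., the measure [ds] is Lebesgue measure
    [m] restricted to [G], so the elements of [F^(s)_e] are the primitives of
    functions [f] in [L^2] supported by [G] that vanish at the finite ends of the
    scale.  Given [u] in [F_e], subtract the primitive [u1] of
    [f = 1_G (u' - c)], where [c] is the mean of [u'] on [G] if [m G] is finite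
    (so that [u1] has the same limit at both ends) and [c = 0] otherwise.  The
    remainder has derivative [c] on [G], and such functions are orthogonal to
    [F^(s)_e] because [c * \int f = c * (u1 +oo - u1 -oo) = 0].  Conversely, if
    [u] is orthogonal to its own [u1], then [0 = \int u' f = \int f^2] since
    [u' f = f^2 + c f], hence [u' = c] a.e. on [G].

    That absolutely continuous functions are a.e. differentiable is obtained from
    the Jordan decomposition by total variations: the Lebesgue-Stieltjes measure
    of a nondecreasing absolutely continuous function is dominated by [m], and
    its Radon-Nikodym density is the derivative by Lebesgue differentiation. *)

Require Import Defs.
From HB Require Import structures.
From mathcomp Require Import all_boot all_order all_algebra.
From mathcomp Require Import all_classical all_reals all_analysis.
From mathcomp Require Import measurable_realfun ring lra.
Import Order.TTheory GRing.Theory Num.Theory.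
Import numFieldNormedType.Exports.
Set Implicit Arguments. Unset Strict Implicit. Unset Printing Implicit Defensive.
Local Open Scope classical_set_scope.
Local Open Scope ring_scope.

(** * Absolute continuity over finite families of intervals, and total variation *)

Definition sep {R : realType} (p q : R * R) : bool := (p.2 <= q.1) || (q.2 <= p.1).

Lemma sepC (R : realType) (p q : R * R) : sep p q = sep q p.
Proof. by rewrite /sep orbC. Qed.

Definition subitv {R : realType} (a b : R) (p : R * R) : bool :=
  [&& a <= p.1, p.1 <= p.2 & p.2 <= b].

(** Absolute continuity on [[a, b]] with families given as sequences rather than as functions on
    ['I_n], so that families can be concatenated and an interval can be replaced by a partition of
    it. *)
Definition ac_seq {R : realType} (u : R -> R) (a b : R) : Prop :=
  forall eps : R, 0 < eps -> exists2 delta : R, 0 < delta &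
    forall L : seq (R * R), all (subitv a b) L -> pairwise sep L ->
      \sum_(p <- L) (p.2 - p.1) < delta ->
      \sum_(p <- L) `|u p.2 - u p.1| < eps.

Lemma abs_continuous_seq (R : realType) (u : R -> R) (a b : R) :
  abs_continuous u -> a <= b -> ac_seq u a b.
Proof.
move=> acu ab eps e0; have [d [d0 H]] := acu a b ab eps e0.
exists d => // L Lab Lsep.
pose x (i : 'I_(size L)) := (nth (0, 0) L i).1.
pose y (i : 'I_(size L)) := (nth (0, 0) L i).2.
have Lxy i : subitv a b (nth (0, 0) L (i : 'I_(size L))).
  by apply: (allP Lab); apply: mem_nth.
rewrite !(big_nth (0, 0)) !big_mkord => Hd; apply: (H _ x y).
- by move=> i; have /and3P[] := Lxy i.
- move=> i j ij; apply/orP; rewrite -/(sep (nth (0, 0) L i) (nth (0, 0) L j)).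
  wlog ltij : i j ij / (i < j)%N.
    move=> W; move: (ij); rewrite -val_eqE /= neq_ltn => /orP[/W->//|ji].
    by rewrite sepC W// eq_sym.
  by apply: (pairwiseP (0, 0) Lsep); rewrite ?inE.
- apply: le_lt_trans Hd; apply: ler_sum => i _ /=.
  by rewrite ger0_norm// subr_ge0; have /and3P[] := Lxy i.
Qed.

(** [zip (x :: l) l] lists the cells of the partition [x :: l]. Being mutually separated and
    contained in the original interval, they can replace it in a separated family. *)
Lemma pairwise_sep_zip (R : realType) (x : R) (l : seq R) : path <%R x l ->
  [/\ x <= last x l, all (subitv x (last x l)) (zip (x :: l) l) &
    pairwise sep (zip (x :: l) l)].
Proof.
elim: l x => //= y l IH x /andP[xy yl].
have [yl' A B] := IH _ yl; split.
- exact: le_trans (ltW xy) yl'.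
- rewrite /subitv /= lexx (ltW xy) yl' /=.
  by apply: sub_all A => p /and3P[yp -> ->]; rewrite (le_trans (ltW xy) yp).
- rewrite B andbT; apply/allP => p /(allP A) /and3P[yp _ _].
  by rewrite /sep /= yp.
Qed.

Lemma sum_zip_telescope (R : realType) (x : R) (l : seq R) :
  \sum_(p <- zip (x :: l) l) (p.2 - p.1) = last x l - x.
Proof.
elim: l x => [|y l IH] x /=; first by rewrite big_nil subrr.
by rewrite big_cons IH /=; lra.
Qed.

Lemma variation_sum_zip (R : realType) (x y : R) (u : R -> R) (l : seq R) :
  itv_partition x y l ->
  variation x y u l = \sum_(p <- zip (x :: l) l) `|u p.2 - u p.1|.
Proof.
move=> P; rewrite variation_zip//; case: P => _ _.
elim: l x => [|z l IH] x /=; first by rewrite !big_nil.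
by rewrite !big_cons IH.
Qed.

(* Intervals move one at a time from [L2], where only the increment of [u] counts,
   to [L1], where its total variation does: each partition of the next interval
   of [L1] is appended to [L2]. *)
Lemma sum_total_variation_le (R : realType) (u : R -> R) (a b : R) (eps delta : R) :
  (forall L : seq (R * R), all (subitv a b) L -> pairwise sep L ->
      \sum_(p <- L) (p.2 - p.1) < delta ->
      \sum_(p <- L) `|u p.2 - u p.1| < eps) ->
  forall L1 L2 : seq (R * R),
    all (subitv a b) (L1 ++ L2) -> pairwise sep (L1 ++ L2) ->
    \sum_(p <- L1 ++ L2) (p.2 - p.1) < delta ->
    (\sum_(p <- L1) total_variation p.1 p.2 u
      + (\sum_(p <- L2) `|u p.2 - u p.1|)%:E <= eps%:E)%E.
Proof.
move=> H; elim=> [|[x y] L1 IH] L2.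
  by move=> A B C; rewrite big_nil add0e lee_fin ltW// H.
rewrite cat_cons /= => /andP[xyab Aab] /andP[xyA Asep]; rewrite big_cons /= => Ad.
have xy : x <= y by have /and3P[] := xyab.
rewrite big_cons /= -addeA.
have S0 : (0 <= \sum_(p <- L1) total_variation p.1 p.2 u)%E.
  rewrite big_seq; apply: sume_ge0 => p pL; apply: total_variation_ge0.
  by move: Aab; rewrite all_cat => /andP[/allP/(_ _ pL)/and3P[]].
have V l : itv_partition x y l -> ((variation x y u l)%:E +
   (\sum_(p <- L1) total_variation p.1 p.2 u +
     (\sum_(p <- L2) `|u p.2 - u p.1|)%:E) <= eps%:E)%E.
  move=> P; rewrite variation_sum_zip// addeCA -EFinD -big_cat; apply: IH.
  - case: P => /pairwise_sep_zip[_ A _] /eqP lxy; rewrite lxy in A.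
    rewrite catA all_cat (_ : all _ (L1 ++ _)) ?andTb//; last first.
      rewrite all_cat; apply/andP; split; first by move: Aab; rewrite all_cat => /andP[].
      apply: sub_all A => p /and3P[xp pp py]; case/and3P: xyab => /= ax _ yb.
      by rewrite /subitv (le_trans ax xp) pp (le_trans py yb).
    by move: Aab; rewrite all_cat => /andP[].
  - case: P => /pairwise_sep_zip[_ A B] /eqP lxy; rewrite lxy in A.
    have Zsep p q : p \in zip (x :: l) l -> sep (x, y) q -> sep p q.
      move=> /(allP A)/and3P[xp _ py]; rewrite /sep /= => /orP[yq|qx].
        by rewrite (le_trans py yq).
      by rewrite (le_trans qx xp) orbT.
    move: Asep; rewrite !pairwise_cat => /and3P[L12 -> ->]; rewrite B andbT /=.
    rewrite allrel_catr L12 !andbT; apply/andP; split; apply/allrelP => p q pL qL.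
      by rewrite sepC; apply: Zsep => //; apply: (allP xyA); rewrite mem_cat pL.
    by apply: Zsep => //; apply: (allP xyA); rewrite mem_cat qL orbT.
  - case: P => _ /eqP lxy; move: Ad; rewrite !big_cat /= sum_zip_telescope lxy; lra.
set X := (\sum_(p <- L1) total_variation p.1 p.2 u + (\sum_(p <- L2) `|u p.2 - u p.1|)%:E)%E in V *.
have X0 : (0 <= X)%E by rewrite adde_ge0// lee_fin sumr_ge0.
(* One partition suffices to bound [X] through [V], hence to make it finite. A finite [X] can be
   moved to the other side, where the supremum over all partitions is taken. *)
have [l0 P0] : exists l, itv_partition x y l.
  have [<-|xney] := eqVneq x y; first by exists [::]; split.
  by exists [:: y]; split; rewrite /= ?andbT ?lt_neqAle ?xney.
have Xfin : X \is a fin_num.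
  rewrite ge0_fin_numE//; apply: le_lt_trans (ltry eps).
  by apply: le_trans (V _ P0); rewrite leeDr// lee_fin sumr_ge0.
rewrite -leeBrDr//; apply: ge_ereal_sup => _ [_ [l P <-] <-].
by rewrite leeBrDr// V.
Qed.

(** Absolute continuity with [eps = 1] bounds the variation by 1 on intervals shorter than [d].
    Finitely many steps of length [d / 2] exhaust [[a, b]], and variation is additive. *)
Lemma total_variation_fin_num (R : realType) (u : R -> R) (a b : R) :
  abs_continuous u -> a <= b -> total_variation a b u \is a fin_num.
Proof.
move=> acu ab; have [d d0 H] := abs_continuous_seq acu ab ltr01.
have step x y : a <= x -> x <= y -> y <= b -> y - x < d ->
    total_variation x y u \is a fin_num.
  move=> ax xy yb yxd.
  have := @sum_total_variation_le _ _ _ _ _ _ H [:: (x, y)] [::].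
  rewrite /= !big_seq1 big_nil adde0 /= andbT => /(_ _ isT yxd) A.
  rewrite ge0_fin_numE ?total_variation_ge0//; apply: le_lt_trans (ltry 1).
  by apply: A; rewrite /subitv /= ax xy.
have [n nd] : exists n : nat, b - a < n.+1%:R * (d / 2).
  exists (Num.truncn ((b - a) / (d / 2))).
  rewrite -ltr_pdivrMr ?divr_gt0//.
  by rewrite truncnS_gt.
have main k x : a <= x -> x <= b -> x - a <= k%:R * (d / 2) ->
    total_variation a x u \is a fin_num.
  elim: k x => [|k IH] x ax xb.
    rewrite mul0r => xa; have -> : x = a by lra.
    by rewrite total_variationxx.
  move=> xk; have [xd|xd] := leP (x - a) (d / 2).
    by apply: step => //; lra.
  rewrite (@total_variationD _ _ _ (x - d / 2)); [|lra|lra].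
  rewrite fin_numD IH ?step//; lra.
by apply: (main n.+1) => //; exact: ltW.
Qed.

(** * Lebesgue-Stieltjes measures of absolutely continuous monotone functions do not charge null
    sets *)

Lemma lebesgue_stieltjes_itvoc (R : realType) (f : cumulative R R) (x y : R) :
  x <= y -> lebesgue_stieltjes_measure f `]x, y]%classic = (f y - f x)%:E.
Proof.
move=> xy; rewrite /lebesgue_stieltjes_measure/= /measure_extension/=.
rewrite measurable_mu_extE/=; last exact: is_ocitv.
by rewrite wlength_itv_bnd.
Qed.

Lemma ds_itvoc (R : realType) (F : R -> R) (x y : R) :
  {homo F : x y / x <= y} -> (forall x, F @ at_right x --> F x) -> x <= y ->
  ds F `]x, y]%classic = (F y - F x)%:E.
Proof.
move=> ndF rcF xy; rewrite /ds; case: pselect => [H|[]//].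
exact: lebesgue_stieltjes_itvoc.
Qed.

Section dominated.
Context (R : realType) (F : R -> R) (a b : R).
Hypotheses (ab : a < b) (ndF : {homo F : x y / x <= y})
  (rcF : forall x, F @ at_right x --> F x) (acF : ac_seq F a b).
Local Notation mu := (@lebesgue_measure R).

Let c n k : R := a + (b - a) * (k%:R / n.+1%:R).

Let c_le n : {homo c n : i j / (i <= j)%N >-> i <= j}.
Proof.
move=> i j ij; rewrite /c lerD2l ler_pM2l ?subr_gt0//.
by rewrite ler_pM2r ?invr_gt0// ler_nat.
Qed.

Let c0 n : c n 0 = a. Proof. by rewrite /c mul0r mulr0 addr0. Qed.
Let cn n : c n n.+1 = b. Proof. by rewrite /c divff// mulr1 addrC subrK. Qed.

Let cS n k : c n k.+1 - c n k = (b - a) / n.+1%:R.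
Proof. by rewrite /c -natr1; ring. Qed.

Let cell_of n x : a < x <= b -> exists2 k, (k < n.+1)%N & c n k < x <= c n k.+1.
Proof.
move=> /andP[ax xb].
have ex : exists k, x <= c n k by exists n.+1; rewrite cn.
case: (ex_minnP ex) => -[|k] xk kmin; first by move: xk; rewrite c0 leNgt ax.
exists k; first by apply: kmin; rewrite cn.
by rewrite xk andbT ltNge; apply/negP => /kmin; rewrite ltnn.
Qed.

(* [cell U n k] is the [k]-th of [n + 1] equal cells of [`]a, b]] if it lies in [U],
   and is empty otherwise: for each [n] they are disjoint, so absolute continuity
   applies to their union, which is contained in [U]. *)
Let q (U : set R) n k := if `[< `]c n k, c n k.+1] `<=` U >] then c n k.+1 else c n k.
Let cell U n k : set R := `]c n k, q U n k].

Let q_bound U n k : c n k <= q U n k <= c n k.+1.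
Proof. by rewrite /q; case: ifP; rewrite lexx c_le. Qed.

Let cell_sub U n k : cell U n k `<=` U.
Proof.
rewrite /cell /q; case: ifPn => [/asboolP//|_].
by rewrite set_itv_ge// bnd_simp ltxx.
Qed.

Let mcell U n k : measurable (cell U n k).
Proof. exact: measurable_itv. Qed.

(** The cells retained in [U] have total length at most [mu U < d], so absolute continuity bounds
    the sum of their increments of [F], and subadditivity bounds the measure of their union. *)
Let cell_bound U e d :
  (forall L : seq (R * R), all (subitv a b) L -> pairwise sep L ->
      \sum_(p <- L) (p.2 - p.1) < d ->
      \sum_(p <- L) `|F p.2 - F p.1| < e) ->
  open U -> (mu U < d%:E)%E -> forall n,
  (ds F (\big[setU/set0]_(k < n.+1) cell U n k) <= e%:E)%E.
Proof.
move=> H oU mUd n; apply: le_trans.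
  by apply: Boole_inequality => k _; exact: mcell.
pose L := [seq (c n k, q U n k) | k <- index_iota 0 n.+1].
have qb k : c n k <= q U n k by have /andP[] := q_bound U n k.
have qb' k : q U n k <= c n k.+1 by have /andP[] := q_bound U n k.
rewrite (eq_bigr (fun k : 'I_n.+1 => (F (q U n k) - F (c n k))%:E)); last first.
  by move=> k _; exact: ds_itvoc.
rewrite sumEFin lee_fin -(big_mkord xpredT (fun k => F (q U n k) - F (c n k))).
apply: ltW; apply: (@le_lt_trans _ _ (\sum_(p <- L) `|F p.2 - F p.1|)).
  by rewrite big_map; apply: ler_sum => k _ /=; exact: ler_norm.
apply: H.
- apply/allP => p /mapP[k]; rewrite mem_index_iota => /andP[_ kn] ->.
  rewrite /subitv /= qb -{1}(c0 n) c_le//= -(cn n).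
  by apply: le_trans (qb' _) _; exact: c_le.
- rewrite pairwise_map; have := iota_ltn_sorted 0 (n.+1 - 0).
  rewrite sorted_pairwise; last exact: ltn_trans.
  apply: sub_pairwise => i j /= ij; rewrite /sep /=.
  by rewrite (le_trans (qb' _))// c_le.
- rewrite big_map /= -lte_fin; apply: le_lt_trans mUd.
  rewrite big_mkord -sumEFin.
  rewrite (_ : (\sum_(i < n.+1) _)%E = (\sum_(i < n.+1) mu (cell U n i))%E); last first.
    apply: eq_bigr => i _; rewrite lebesgue_measure_itv/= lte_fin.
    by case: ltgtP (qb i) => // -> _; rewrite subrr.
  rewrite -measure_bigsetU//; last first.
    apply/trivIsetP => i j _ _.
    wlog ij : i j / (i < j)%N.
      move=> W /[dup] ij; rewrite neq_ltn => /orP[/W|/W]; first exact.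
      by rewrite setIC eq_sym; exact.
    move=> _; rewrite /cell -subset0 => x [] /=; rewrite !in_itv/= => /andP[_ xi] /andP[jx _].
    have := le_trans xi (qb' i) => /(lt_le_trans jx).
    by rewrite ltNge c_le.
  by move=> i; exact: mcell.
  apply: le_measure; rewrite ?inE//.
  + by apply: bigsetU_measurable => i _; exact: mcell.
  + exact: open_measurable.
  + by rewrite -bigcup_mkord => x [i _ /cell_sub].
Qed.

(** Outer regularity encloses [A] in an open [U] with [mu U < d]. The cells of finer and finer grids
    lying in [U] eventually capture each point of [A]. Each finite union of cells has measure at
    most [e], and continuity from below passes this to [A]. *)
Lemma ds_null_of_ac (A : set R) : measurable A -> A `<=` `]a, b] -> mu A = 0%E ->
  ds F A = 0%E.
Proof.
move=> mA Aab A0; apply/eqP; rewrite eq_le measure_ge0 andbT.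
apply/lee_addgt0Pr => e e0; rewrite add0e.
have [d d0 H] := acF e0.
have Aoo : (mu A < +oo)%E by rewrite A0 ltry.
have [U [oU AU UAd]] := @lebesgue_regularity_outer R A d mA Aoo d0.
have mU : measurable U by exact: open_measurable.
have mUd : (mu U < d%:E)%E.
  have -> : mu U = (mu (U `\` A) + mu (U `&` A))%E by exact: measureDI.
  rewrite (_ : mu (U `&` A) = 0%E) ?adde0//.
  by rewrite setIC setIidl.
pose B n := \big[setU/set0]_(k < n.+1) cell U n k.
have mB n : measurable (B n) by apply: bigsetU_measurable => i _; exact: mcell.
(* [B] is not monotone; a point of [U] lies in [B n] for all large [n]. *)
pose V n := \bigcap_k B (n + k)%N.
have mV n : measurable (V n) by apply: bigcapT_measurable.
have AV : A `<=` \bigcup_n V n.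
  move=> x Ax; have xab := Aab _ Ax.
  have [r /= r0 rU] : exists2 r : R, 0 < r & ball x r `<=` U.
    by apply/nbhs_ballP; apply: open_nbhs_nbhs; split => //; exact: AU.
  (* From the index [N] on, the mesh is below [r], so the cell containing [x] stays in the ball
     around [x], hence in [U]. *)
  pose N := Num.truncn ((b - a) / r).
  exists N => // j' _; set j := (N + j')%N; rewrite /B -bigcup_mkord.
  have xab' : a < x <= b by move: xab; rewrite /= in_itv.
  have [k kn /andP[cx xc]] := @cell_of j x xab'.
  exists k => //; rewrite /cell /q; case: ifPn => [_|/asboolP[]] /=.
    by rewrite in_itv/= cx.
  move=> y /=; rewrite in_itv/= => /andP[cy yc]; apply: rU.
  have small : c j k.+1 - c j k < r.
    rewrite cS ltr_pdivrMr// mulrC -ltr_pdivrMr//.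
    by rewrite (lt_le_trans (truncnS_gt _))// ler_nat ltnS leq_addr.
  rewrite /ball /= ltr_norml; lra.
apply: (@le_trans _ _ (ds F (\bigcup_n V n))).
  by apply: le_measure; rewrite ?inE//; exact: bigcupT_measurable.
have ndV : nondecreasing_seq V.
  move=> n m nm; apply/subsetPset => x Vx k _.
  by have := Vx (m - n + k)%N Logic.I; rewrite addnA subnKC.
have := @nondecreasing_cvg_mu _ _ _ (ds F) V mV (bigcupT_measurable _ mV) ndV.
move=> /cvg_lim <-//; apply: lime_le.
  apply: ereal_nondecreasing_is_cvgn => n m nm; rewrite /=.
  apply: le_measure; rewrite ?inE; [exact: mV|exact: mV|].
  by apply/subsetPset; exact: ndV.
apply: nearW => n /=; apply: (@le_trans _ _ (ds F (B n))).
  apply: le_measure; rewrite ?inE; [exact: mV|exact: mB|] => x Vx.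
  by have := Vx 0%N Logic.I; rewrite addn0.
exact: (cell_bound H oU mUd n).
Qed.

End dominated.

(** * Almost everywhere differentiability of absolutely continuous functions *)

Lemma lebesgue_ae_filter (R : realType) :
  Filter (almost_everywhere (@lebesgue_measure R)).
Proof. exact: (ae_filter_ringOfSetsType (@lebesgue_measure R)). Qed.
#[local] Existing Instance lebesgue_ae_filter.

Lemma ae_eq_integrable d (T : measurableType d) (R : realType)
  (mu : {measure set T -> \bar R}) (D : set T) (f g : T -> \bar R) :
  measurable D -> measurable_fun D g -> ae_eq mu D f g ->
  mu.-integrable D f -> mu.-integrable D g.
Proof.
move=> mD mg fg /integrableP[mf foo]; apply/integrableP; split => //.
rewrite (@ge0_ae_eq_integral _ _ _ _ _ _ (abse \o f))//.
- exact: measurableT_comp.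
- exact: measurableT_comp.
- by move=> x _; exact: abse_ge0.
- by apply: ae_eq_sym; exact: ae_eq_abse.
Qed.

(** [g] is the Radon-Nikodym density of the Stieltjes measure of [F] restricted to []a, b]], which
    [ds_null_of_ac] shows to be dominated by Lebesgue measure. *)
Lemma monotone_ac_density (R : realType) (F : R -> R) (a b : R) : a < b ->
  {in `[a, b] &, {homo F : x y / x <= y}} -> ac_seq F a b ->
  exists2 g : R -> R, (@lebesgue_measure R).-integrable setT (EFin \o g) &
    forall x, a <= x <= b ->
      F x = F a + \int[@lebesgue_measure R]_(t in `]a, x]) g t.
Proof.
move=> ab ndF acF; set mu := @lebesgue_measure R.
(* Composing with [clip] extends [F] by constants outside [[a, b]], giving a monotone
   right-continuous function on the whole line, as [ds] requires. Right continuity uses that [clip]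
   is 1-Lipschitz. *)
pose clip x := Num.max a (Num.min x b).
have clip_in x : clip x \in `[a, b].
  by rewrite in_itv/= /clip le_max lexx /= ge_max (ltW ab) ge_min lexx orbT.
have clip_id x : a <= x <= b -> clip x = x.
  by move=> /andP[ax xb]; rewrite /clip min_l// max_r.
have clip_le : {homo clip : x y / x <= y}.
  by move=> x y xy; apply: le_max2 => //; apply: le_min2.
have clip_lip x y : x <= y -> clip y - clip x <= y - x.
  move=> xy; rewrite /clip /Num.max /Num.min.
  by case: (ltP x b) => ?; case: (ltP y b) => ?; case: ltP => ?; case: ltP => ?; lra.
pose H := F \o clip.
have ndH : {homo H : x y / x <= y} by move=> x y xy; apply: ndF => //; exact: clip_le.
have rcH x : H @ at_right x --> H x.
  apply/cvgrPdist_lt => e e0; have [d d0 Hd] := acF _ e0.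
  near=> y.
  have xy : x < y by near: y; exact: nbhs_right_gt.
  have yd : y < x + d by near: y; apply: nbhs_right_lt; rewrite ltrDl.
  have := Hd [:: (clip x, clip y)]; rewrite !big_seq1 /= distrC; apply=> //.
    move: (clip_in x) (clip_in y); rewrite !in_itv/= => /andP[ax _] /andP[_ yb].
    by rewrite andbT; apply/and3P; split => //; exact/clip_le/ltW.
  by apply: le_lt_trans (clip_lip _ _ (ltW xy)) _; lra.
have acH : ac_seq H a b.
  move=> e e0; have [d d0 Hd] := acF _ e0; exists d => // L Lab Lsep Ld.
  rewrite (eq_big_seq (fun p => `|F p.2 - F p.1|)); first exact: Hd.
  move=> p /(allP Lab)/and3P[ap pp pb]; rewrite /H /= !clip_id//.
    by rewrite ap (le_trans pp pb).
  by rewrite (le_trans ap pp) pb.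
have mab : measurable (`]a, b]%classic : set (measurableTypeR R)) by exact: measurable_itv.
have dsab : (ds H `]a, b]%classic < +oo)%E by rewrite ds_itvoc ?ltW// ltry.
pose nu : {finite_measure set (measurableTypeR R) -> \bar R} := mfrestr mab dsab.
have numu : nu `<< mu.
  apply/null_content_dominatesP => A mA A0; rewrite /nu/= /mfrestr /mrestr.
  apply: (@ds_null_of_ac R H a b) => //; first exact: measurableI.
  by apply: (@subset_measure0 _ _ _ mu _ A) => //; exact: measurableI.
have [f [f0 ffin fint fE]] := radon_nikodym_sigma_finite numu.
have ffE : EFin \o (fine \o f) = f by apply/funext => x /=; rewrite fineK.
exists (fine \o f); first by rewrite ffE.
move=> x /andP[ax xb].
have mx : measurable (`]a, x]%classic : set (measurableTypeR R)) by exact: measurable_itv.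
have := fE _ mx; rewrite /nu/= /mfrestr /mrestr setIidl; last first.
  by apply: subset_itvl; rewrite bnd_simp.
rewrite ds_itvoc// /H /= !clip_id ?ax ?lexx ?xb ?ltW// => E.
rewrite /Rintegral; have -> : (\int[mu]_(t in `]a, x]) ((fine \o f) t)%:E = (F x - F a)%:E)%E.
  by rewrite E; apply: eq_integral => t _ /=; rewrite fineK.
by rewrite /= addrC subrK.
Unshelve. all: by end_near. Qed.

(** Lebesgue differentiation of the indefinite integral of [g], transferred to [F] because the two
    agree up to [F a] in a neighbourhood of each interior point. *)
Lemma derivable_primitive (R : realType) (F g : R -> R) (a b : R) : a < b ->
  (@lebesgue_measure R).-integrable setT (EFin \o g) ->
  (forall x, a <= x <= b ->
      F x = F a + \int[@lebesgue_measure R]_(t in `]a, x]) g t) ->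
  {ae @lebesgue_measure R, forall x, a < x < b -> derivable F x 1 /\ derive1 F x = g x}.
Proof.
move=> ab gint FE.
have lg : locally_integrable setT g by apply: open_integrable_locally => //; exact: openT.
have gi y : (@lebesgue_measure R).-integrable [set` Interval (BRight a) (BRight y)] (EFin \o g).
  by apply: integrableS gint => //; exact: measurable_itv.
have := FTC1 gi lg; apply: filterS => x Hx /andP[ax xb].
have [D1 D2] := Hx ax.
have nE : \forall z \near x, F a + \int[@lebesgue_measure R]_(t in `]a, z]) g t = F z.
  near=> z; apply/esym/FE/andP; split; apply: ltW; near: z.
    exact: lt_nbhsr.
  exact: lt_nbhsl.
have D : is_derive x 1 F (g x).
  apply: (near_eq_is_derive nE).
  rewrite -[g x]add0r; apply: is_deriveD.
  by rewrite -D2 derive1E; apply: DeriveDef.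
split; first exact: (@ex_derive _ _ _ _ _ _ _ D).
by rewrite derive1E (@derive_val _ _ _ _ _ _ _ D).
Unshelve. all: by end_near. Qed.

(** The Radon-Nikodym density of [s] is almost everywhere its derivative, hence [h]. For the scale,
    with [h = \1_G], this turns the hypothesis on [s'] into a formula for increments. *)
Lemma increment_abs_continuous (R : realType) (s h : R -> R) :
  {homo s : x y / x <= y} -> abs_continuous s -> measurable_fun setT h ->
  {ae @lebesgue_measure R, forall x, derivable s x 1 /\ derive1 s x = h x} ->
  forall x y, x <= y -> (@lebesgue_measure R).-integrable `]x, y] (EFin \o h) /\
    s y - s x = \int[@lebesgue_measure R]_(t in `]x, y]) h t.
Proof.
move=> nds acs mh hE x y xy; set mu := @lebesgue_measure R.
(* The right end [y + 1] gives a nondegenerate interval even when [x = y], and makes every point of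
   []x, y]] interior. *)
have xy1 : x < y + 1 by rewrite (le_lt_trans xy)// ltrDl.
have nds' : {in `[x, y + 1] &, {homo s : x y / x <= y}} by move=> ? ? _ _; exact: nds.
have [g gint gE] := monotone_ac_density xy1 nds' (abs_continuous_seq acs (ltW xy1)).
have hg : ae_eq mu `]x, y]%classic (EFin \o g) (EFin \o h).
  have := derivable_primitive xy1 gint gE.
  apply: filterS2 hE => t [_ ht] Ht /=; rewrite in_itv/= => /andP[xt ty].
  have [|_ gt] := Ht; first by rewrite xt (le_lt_trans ty)// ltrDl.
  by rewrite -ht gt.
have mxy : measurable (`]x, y]%classic : set R) by exact: measurable_itv.
have gxy : mu.-integrable `]x, y] (EFin \o g) by exact: integrableS gint.
have mh' : measurable_fun `]x, y] (EFin \o h).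
  by apply/measurable_EFinP; exact: measurable_funTS.
split; first by apply: (ae_eq_integrable _ _ hg gxy).
have -> : s y - s x = \int[mu]_(t in `]x, y]) g t.
  by rewrite (gE y) ?xy ?lerDl//; lra.
rewrite /Rintegral; congr fine.
by apply: ae_eq_integral => //; exact: measurable_int gxy.
Qed.

(** On each bounded window, [u = V - (V - u)] with [V] the variation from the left end. Both terms
    are nondecreasing and absolutely continuous, so both have densities and are differentiable
    almost everywhere. *)
Lemma abs_continuous_derivable (R : realType) (u : R -> R) : abs_continuous u ->
  {ae @lebesgue_measure R, forall x, derivable u x 1}.
Proof.
move=> acu; set mu := @lebesgue_measure R.
suff main n : {ae mu, forall x, - n.+1%:R < x < n.+1%:R -> derivable u x 1}.
  have := ae_foralln main; apply: filterS => x Hx.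
  apply: (Hx (Num.truncn `|x|)); rewrite -ltr_norml; exact: truncnS_gt.
set a : R := - n.+1%:R; set b : R := n.+1%:R.
have ab : a < b by rewrite /a /b gtrN.
pose V x := fine (total_variation a x u).
have VB (x y : R) : a <= x -> x <= y -> V y - V x = fine (total_variation x y u).
  move=> ax xy; rewrite /V (total_variationD _ ax xy) fineD ?total_variation_fin_num//.
  by rewrite addrC addKr.
have uV (x y : R) : a <= x -> x <= y -> `|u y - u x| <= V y - V x.
  move=> ax xy; rewrite VB// -lee_fin fineK ?total_variation_fin_num//.
  exact: total_variation_ge.
have acV : ac_seq V a b.
  (* Half of [e] is used because the bound on the variations, being a supremum, is not strict. *)
  move=> e e0; have [d d0 H] := abs_continuous_seq acu (ltW ab) (divr_gt0 e0 (ltr0Sn _ 1)).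
  exists d => // L Lab Lsep Ld.
  have := sum_total_variation_le H (L1 := L) (L2 := [::]).
  rewrite cats0 big_nil adde0 => /(_ Lab Lsep Ld) TV.
  apply: (@le_lt_trans _ _ (e / 2)); last by rewrite ltr_pdivrMr// ltr_pMr// ltr1n.
  rewrite -lee_fin; apply: le_trans TV; rewrite -sumEFin !big_seq.
  apply: lee_sum => p /(allP Lab)/and3P[ap pp pb].
  by rewrite VB// ger0_norm ?fine_ge0 ?total_variation_ge0// fineK// total_variation_fin_num.
have ndV : {in `[a, b] &, {homo V : x y / x <= y}}.
  move=> x y; rewrite !in_itv/= => /andP[ax _] _ xy; rewrite -subr_ge0.
  exact: le_trans (uV _ _ ax xy).
have ndVu : {in `[a, b] &, {homo (V \- u) : x y / x <= y}}.
  move=> x y; rewrite !in_itv/= => /andP[ax _] _ xy /=.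
  have := le_trans (ler_norm _) (uV _ _ ax xy); lra.
have acVu : ac_seq (V \- u) a b.
  move=> e e0; have e20 : 0 < e / 2 by rewrite divr_gt0.
  have [d1 d10 H1] := acV _ e20.
  have [d2 d20 H2] := abs_continuous_seq acu (ltW ab) e20.
  exists (Num.min d1 d2); first by rewrite lt_min d10.
  move=> L Lab Lsep; rewrite lt_min => /andP[Ld1 Ld2].
  rewrite [ltRHS](splitr e); apply: le_lt_trans (ltrD (H1 _ Lab Lsep Ld1) (H2 _ Lab Lsep Ld2)).
  rewrite -big_split; apply: ler_sum => p _ /=.
  have -> : V p.2 - u p.2 - (V p.1 - u p.1) = (V p.2 - V p.1) - (u p.2 - u p.1) by lra.
  exact: ler_normB.
have [g1 g1i g1E] := monotone_ac_density ab ndV acV.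
have [g2 g2i g2E] := monotone_ac_density ab ndVu acVu.
have := derivable_primitive ab g2i g2E.
have := derivable_primitive ab g1i g1E.
apply: filterS2 => x H1 H2 xab; have [D1 _] := H1 xab; have [D2 _] := H2 xab.
rewrite (_ : u = V \- (V \- u)); last by apply/funext => z /=; ring.
exact: derivableB.
Qed.

(** * Continuity and differences of absolutely continuous functions; measurability of [dderiv] *)

Lemma abs_continuous_continuous (R : realType) (u : R -> R) : abs_continuous u -> continuous u.
Proof.
move=> acu x; apply/cvgrPdist_lt => e e0.
have xx : x - 1 <= x + 1 by lra.
have [d d0 H] := abs_continuous_seq acu xx e0.
have m0 : 0 < Num.min d 1 by rewrite lt_min d0 ltr01.
have := nbhsx_ballx x _ m0; apply: filterS => y; rewrite /ball /= => yd.
move: yd; rewrite lt_min => /andP[]; rewrite 2!ltr_distl => /andP[d1 d2] /andP[d3 d4].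
have [xy|yx] := leP x y.
  rewrite distrC; have := H [:: (x, y)]; rewrite !big_seq1 /=; apply=> //; last by lra.
  by rewrite /subitv /= xy; apply/andP; split => //; apply/andP; split; lra.
have := H [:: (y, x)]; rewrite !big_seq1 /=; apply=> //; last by lra.
by rewrite /subitv /= (ltW yx); apply/andP; split => //; apply/andP; split; lra.
Qed.

Lemma abs_continuousB (R : realType) (u v : R -> R) :
  abs_continuous u -> abs_continuous v -> abs_continuous (fun x => u x - v x).
Proof.
move=> acu acv a b ab e e0; have e20 : 0 < e / 2 by rewrite divr_gt0.
have [d1 [d10 H1]] := acu a b ab _ e20.
have [d2 [d20 H2]] := acv a b ab _ e20.
exists (Num.min d1 d2); split; first by rewrite lt_min d10.
move=> n x y xyab xyd; rewrite lt_min => /andP[x1 x2].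
rewrite [ltRHS]splitr.
apply: le_lt_trans (ltrD (H1 _ _ _ xyab xyd x1) (H2 _ _ _ xyab xyd x2)).
rewrite -big_split; apply: ler_sum => i _ /=.
have -> : u (y i) - v (y i) - (u (x i) - v (x i)) =
  (u (y i) - u (x i)) - (v (y i) - v (x i)) by lra.
exact: ler_normB.
Qed.

Lemma dderivP (R : realType) (u : R -> R) (x : R) :
  derivable u x 1 -> is_derive x 1 u (dderiv u x).
Proof. by move=> D; rewrite /dderiv asboolT// derive1E; exact: DeriveDef. Qed.

Lemma dderivE (R : realType) (u : R -> R) (x l : R) : is_derive x 1 u l -> dderiv u x = l.
Proof.
move=> D; rewrite /dderiv asboolT; last exact: (@ex_derive _ _ _ _ _ _ _ D).
by rewrite derive1E (@derive_val _ _ _ _ _ _ _ D).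
Qed.

Section measurable_dderiv.
Context (R : realType) (u : R -> R).
Hypothesis cu : continuous u.

Let q (h x : R) : R := h^-1 * (u (h + x) - u x).

Let cq h : continuous (q h).
Proof.
move=> x; apply: cvgM; first exact: cvg_cst.
apply: cvgB; last exact: cu.
apply: (@continuous_comp _ _ _ (fun x => h + x) u); last exact: cu.
by apply: cvgD; [exact: cvg_cst|exact: cvg_id].
Qed.

Let derivableE x : derivable u x 1 = cvg (q h x @[h --> 0^']).
Proof.
rewrite /derivable /=.
by under eq_fun do rewrite [_ *: 1]mulr1.
Qed.

Let osc k n : set R := \bigcap_(p in [set p : R * R | [/\ p.1 != 0, `|p.1| < n.+1%:R^-1,
   p.2 != 0 & `|p.2| < n.+1%:R^-1]])
   [set x | `|q p.1 x - q p.2 x| <= k.+1%:R^-1].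

Let closed_osc k n : closed (osc k n).
Proof.
apply: closed_bigI => -[h h'] _ /=.
rewrite (_ : [set x | _] = (fun x => `|q h x - q h' x|) @^-1` [set y | y <= k.+1%:R^-1])//.
apply: preimage_closed; last exact: closed_le.
move=> x _; apply: (@continuous_comp _ _ _ (fun y => q h y - q h' y) Num.norm).
  by apply: cvgB; exact: cq.
exact: norm_continuous.
Qed.

(* Cauchy criterion for the difference quotients; [osc k n] is closed as an
   intersection over all real increments, no countable subfamily being needed. *)
Lemma derivable_set_bigcap :
  [set x | derivable u x 1] = \bigcap_k \bigcup_n osc k n.
Proof.
apply/seteqP; split => x /=; rewrite derivableE.
  move=> /cvg_ex[l /cvgrPdist_le ql] k _.
  have [] := ql (k.+1%:R^-1 / 2); first by rewrite divr_gt0// invr_gt0.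
  move=> e /= e0 He; exists (Num.truncn e^-1) => //.
  have small p : `|p : R| < (Num.truncn e^-1).+1%:R^-1 -> `|p| < e.
    move=> /lt_trans; apply; rewrite invf_plt ?posrE// truncnS_gt//.
  move=> [h h'] /= [h0 /small he h0' /small he'] /=.
  have A := He h; have B := He h'; rewrite /ball_ /= !sub0r !normrN in A B.
  have {}A := A he h0; have {}B := B he' h0'.
  rewrite -(subrKA l) [leRHS]splitr; apply: le_trans (ler_normD _ _) _.
  by rewrite lerD// distrC.
move=> Dx; apply: cauchy_cvg; apply: cauchy_exP => e e0.
have [n _ Hn] := Dx (Num.truncn e^-1) Logic.I.
have n0 : 0 < (n.+1%:R^-1 : R) / 2 by rewrite divr_gt0.
exists (q (n.+1%:R^-1 / 2) x); exists n.+1%:R^-1 => /=; first by rewrite invr_gt0.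
move=> h; rewrite /ball_ /= sub0r normrN => hn h0; rewrite /ball /=.
have /= := Hn (n.+1%:R^-1 / 2, h); rewrite gt_eqF// gtr0_norm//.
rewrite ltr_pdivrMr// ltr_pMr ?invr_gt0// ltr1n => /(_ _)/le_lt_trans; apply => //.
by rewrite invf_plt ?posrE// truncnS_gt.
Qed.

(** The set of differentiability is a countable intersection of countable unions of closed sets. On
    it, the derivative is the limit of the continuous difference quotients with increments
    [1 / (n + 1)]. *)
Lemma measurable_dderiv : measurable_fun setT (dderiv u).
Proof.
pose D := [set x | derivable u x 1].
have mD : measurable (D : set R).
  rewrite /D derivable_set_bigcap; apply: bigcapT_measurable => k.
  by apply: bigcupT_measurable => n; exact: closed_measurable.
rewrite (_ : dderiv u = derive1 u \_ D); last first.
  apply/funext => x; rewrite /dderiv patchE /D.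
  by case: asboolP => Dx; [rewrite mem_set|rewrite memNset].
apply: (measurable_restrictT (derive1 u) mD).1.
apply: (@measurable_fun_cvg _ _ _ _ (fun n => q n.+1%:R^-1)).
  by move=> n; apply: measurable_funTS; exact: continuous_measurable_fun.
move=> x Dx.
have : q h x @[h --> 0^'] --> derive1 u x.
  have dx : derivable u x 1 by exact: Dx.
  by rewrite derivableE in dx.
apply: cvg_comp => P [e /= e0 He]; near=> n; apply: He => //=.
  rewrite sub0r normrN gtr0_norm ?invr_gt0//.
  by near: n; exact: (near_infty_natSinv_lt (PosNum e0)).
Unshelve. all: by end_near. Qed.
End measurable_dderiv.

(** * Square-integrable functions and their primitives *)

Section square_integrable.
Context (R : realType).
Local Notation mu := (@lebesgue_measure R).
Implicit Types (f : R -> R) (D : set R).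

Lemma sqr_integrable f D : measurable_fun setT f ->
  (\int[mu]_x ((f x) ^+ 2)%:E < +oo)%E -> measurable D ->
  mu.-integrable D (EFin \o (fun x => f x ^+ 2)).
Proof.
move=> mf foo mD; apply: (@integrableS _ _ _ _ setT) => //.
apply/integrableP; split.
  by apply/measurable_EFinP; exact: measurable_funX.
have -> : (\int[mu]_x `|(EFin \o (fun x => (f x ^+ 2)%R)) x| = \int[mu]_x ((f x) ^+ 2)%:E)%E.
  by apply: eq_integral => x _ /=; rewrite ger0_norm// sqr_ge0.
by [].
Qed.

(** On a set of finite measure, [|f|] is dominated by the integrable function [f ^ 2 + 1]. *)
Lemma square_integrable_integrable f D : measurable_fun setT f ->
  (\int[mu]_x ((f x) ^+ 2)%:E < +oo)%E -> measurable D -> (mu D < +oo)%E ->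
  mu.-integrable D (EFin \o f).
Proof.
move=> mf foo mD Doo.
have fin1 : mu.-integrable D (EFin \o cst (1 : R)).
  apply/integrableP; split; first exact/measurable_EFinP.
  by under eq_integral do rewrite /= normr1; rewrite integral_cst// mul1e.
have int2 : mu.-integrable D (EFin \o (fun x => f x ^+ 2 + 1)).
  by apply: (integrableD _ (sqr_integrable mf foo mD) fin1).
apply: le_integrable int2 => //.
  by apply/measurable_EFinP; exact: measurable_funTS.
move=> x _ /=; rewrite lee_fin [leRHS]ger0_norm ?addr_ge0 ?sqr_ge0//.
rewrite -[f x ^+ 2]real_normK ?num_real//.
have := sqr_ge0 (`|f x| - 1); nra.
Qed.

End square_integrable.

(** Lebesgue counterpart of the conditions on [du/ds]: [f] is the density with respect to [ds], set
    to zero off [G] so that integrals against [ds] become Lebesgue integrals. *)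
Definition primitive_on {R : realType} (G : set R) (f u : R -> R) : Prop :=
  [/\ measurable_fun setT f, (forall x, ~ G x -> f x = 0),
      (\int[@lebesgue_measure R]_x ((f x) ^+ 2)%:E < +oo)%E &
      forall x y, x <= y -> u y - u x = \int[@lebesgue_measure R]_(t in `]x, y]) f t].

(** * The scale function, its measure, and the passage from [ds] to Lebesgue measure *)

Section scale.
Context (R : realType) (s : R -> R) (G : set R).
Hypotheses (s_incr : forall x y : R, x < y -> s x < s y)
  (s_ac : abs_continuous s)
  (s_deriv : {ae @lebesgue_measure R, forall x,
                derivable s x 1 /\ derive1 s x = \1_G x})
  (G_open : open G).
Local Notation mu := (@lebesgue_measure R).

Lemma scale_homo : {homo s : x y / x <= y}.
Proof. by move=> x y; rewrite le_eqVlt => /predU1P[->//|/s_incr/ltW]. Qed.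

Lemma measurable_G : measurable (G : set R).
Proof. exact: open_measurable. Qed.
Let mG := measurable_G.

Lemma scale_increment x y : x <= y -> s y - s x = \int[mu]_(t in `]x, y]) \1_G t.
Proof.
move=> xy; have mI : measurable_fun setT (\1_G : R -> R) by exact: measurable_indic.
by have [] := increment_abs_continuous scale_homo s_ac mI s_deriv xy.
Qed.

Lemma scale_measure x y : x <= y -> (s y - s x)%:E = mu (G `&` `]x, y]%classic).
Proof.
move=> xy; rewrite scale_increment// /Rintegral.
have -> : (\int[mu]_(t in `]x, y]) (\1_G t)%:E = mu (G `&` `]x, y]%classic))%E.
  by apply: integral_indic => //; exact: measurable_itv.
rewrite fineK// ge0_fin_numE ?measure_ge0//.
apply: (@le_lt_trans _ _ (mu `]x, y]%classic)).
  apply: le_measure; rewrite ?inE; last exact: subIsetr.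
    by apply: measurableI => //; exact: measurable_itv.
  exact: measurable_itv.
by rewrite lebesgue_measure_itv/= lte_fin; case: ifP => _; rewrite -?EFinB ltry.
Qed.

Lemma scale_lip x y : x <= y -> s y - s x <= y - x.
Proof.
move=> xy; rewrite -lee_fin scale_measure//.
apply: (@le_trans _ _ (mu `]x, y]%classic)).
  apply: le_measure; rewrite ?inE; last exact: subIsetr.
    by apply: measurableI => //; exact: measurable_itv.
  exact: measurable_itv.
rewrite lebesgue_measure_itv/= lte_fin; case: ifP => _; rewrite -?EFinB// lee_fin subr_ge0//.
Qed.

(** Both measures agree on half-open intervals by [scale_measure], and a Stieltjes measure is
    determined by these values. *)
Lemma ds_measure (A : set R) : measurable A -> ds s A = mu (A `&` G).
Proof.
(* Monotonicity and right continuity exclude the branch in which [ds s] is the zero measure. *)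
move=> mA; have cs : forall x, s @ at_right x --> s x.
  by apply: right_continuousW; exact: abs_continuous_continuous.
rewrite /ds; case: pselect => [H|[]]; last by split => //; exact: scale_homo.
rewrite /=; rewrite (@lebesgue_stieltjes_measure_unique R _ (mrestr mu mG)) => // X [[a b] _ <-].
have [ab|ba] := leP a b.
  by rewrite lebesgue_stieltjes_itvoc//= scale_measure// setIC.
rewrite set_itv_ge ?bnd_simp -?leNgt ?ltW//.
by rewrite !measure0.
Qed.

(** Cut [D] along [G]: the part outside is [ds]-null, and on the part inside [ds] is Lebesgue
    measure. *)
Lemma ds_integral (D : set R) (f : R -> \bar R) : measurable D ->
  measurable_fun D f -> (\int[ds s]_(x in D) f x = \int[mu]_(x in D) (f \_ G) x)%E.
Proof.
move=> mD mf; rewrite -integral_mkcondr.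
have mDG : measurable (D `&` G) by exact: measurableI.
have mDnG : measurable (D `\` G) by exact: measurableD.
have {1}-> : D = (D `&` G) `|` (D `\` G) by rewrite setUIDK.
rewrite integral_setU//; last 2 first.
- by rewrite setUIDK.
- rewrite disj_set2E; apply/eqP; rewrite -subset0 => x [[_ Gx] [_]] //.
have -> : (\int[ds s]_(x in D `\` G) f x = 0)%E.
  apply: null_set_integral => //; first exact: measurable_funS mf.
  by rewrite ds_measure// (_ : _ `&` G = set0) ?measure0// -subset0 => x [[_]].
rewrite adde0; apply: eq_measure_integral => A mA ADG.
by rewrite ds_measure// setIidl// => x /ADG[].
Qed.

Lemma patch_measurable (f : R -> R) : measurable_fun setT f -> measurable_fun setT (f \_ G).
Proof. by move=> mf; apply: (measurable_restrictT f mG).1; exact: measurable_funTS. Qed.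

(** Passing from [f] to [f \_ G] modifies it on a [ds]-null set only, and both integrals then
    convert by [ds_integral]. *)
Lemma primitive_on_of_dds (u f : R -> R) : dds s u f ->
  (\int[ds s]_x ((f x) ^+ 2)%:E < +oo)%E -> primitive_on G (f \_ G) u.
Proof.
move=> [mf uE] f2; split.
- exact: patch_measurable.
- by move=> x nGx; rewrite patchE memNset.
- move: f2; rewrite ds_integral//; last first.
    by apply/measurable_EFinP; exact: measurable_funX.
  apply: le_lt_trans; rewrite le_eqVlt; apply/orP; left; apply/eqP.
  by apply: eq_integral => x _; rewrite !patchE; case: ifP => // _; rewrite expr0n.
- move=> x y; rewrite le_eqVlt => /predU1P[->|xy].
    by rewrite set_itv_ge ?bnd_simp ?ltxx// Rintegral_set0 subrr.
  have [_] := uE _ _ xy.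
  have -> : (\int[ds s]_(t in `]x, y]) (f t)%:E = \int[mu]_(t in `]x, y]) ((EFin \o f) \_ G) t)%E.
    apply: ds_integral; first exact: measurable_itv.
    by apply: measurable_funTS; exact/measurable_EFinP.
  rewrite /Rintegral => uyx; rewrite -[LHS]/(fine (u y - u x)%:E) uyx; congr fine.
  by apply: eq_integral => t _; rewrite !patchE; case: ifP.
Qed.

Lemma dds_of_primitive_on (u f : R -> R) : primitive_on G f u ->
  dds s u f /\ (\int[ds s]_x ((f x) ^+ 2)%:E < +oo)%E.
Proof.
move=> [mf f0 f2 uE].
(* Applied with [g] the square, the identity and the absolute value. *)
have fG g : g 0 = 0 -> (EFin \o g \o f) \_ G = (EFin \o g \o f) :> (R -> \bar R).
  move=> g0; apply/funext => x; rewrite patchE; case: ifP => //.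
  by move/negbT; rewrite notin_setE => /f0 /= ->; rewrite g0.
split; last first.
  rewrite ds_integral//; last by apply/measurable_EFinP; exact: measurable_funX.
  by rewrite (fG (fun x => x ^+ 2))// expr0n.
split => // x y xy.
have mxy : measurable (`]x, y]%classic : set R) by exact: measurable_itv.
have mEf : measurable_fun `]x, y] (EFin \o f).
  by apply: measurable_funTS; exact/measurable_EFinP.
have fint : mu.-integrable `]x, y] (EFin \o f).
  apply: square_integrable_integrable => //.
  by rewrite lebesgue_measure_itv/= lte_fin; case: ifP => _; rewrite -?EFinB ltry.
have intE : (\int[ds s]_(t in `]x, y]) (f t)%:E = \int[mu]_(t in `]x, y]) (f t)%:E)%E.
  by rewrite ds_integral// (fG id).
split.
  apply/integrableP; split => //.
  have [_] := integrableP _ _ _ fint.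
  rewrite ds_integral//; last exact: measurableT_comp.
  by rewrite (_ : _ \_ G = (fun x => `|(EFin \o f) x|%E))// (fG Num.norm)// normr0.
rewrite intE uE ?ltW// /Rintegral fineK//.
by apply: integrable_fin_num.
Qed.
End scale.

(** * Increment estimates, absolute continuity and derivatives of primitives *)

Section primitives.
Context (R : realType) (s : R -> R) (G : set R).
Hypotheses (s_incr : forall x y : R, x < y -> s x < s y)
  (s_ac : abs_continuous s)
  (s_deriv : {ae @lebesgue_measure R, forall x,
                derivable s x 1 /\ derive1 s x = \1_G x})
  (G_open : open G).
Local Notation mu := (@lebesgue_measure R).
Let ndS := scale_homo s_incr.
Let mG : measurable G := measurable_G G_open.

Lemma bounded_itv_measure_lty (x y : R) : (mu `]x, y]%classic < +oo)%E.
Proof. by rewrite lebesgue_measure_itv/= lte_fin; case: ifP => _; rewrite -?EFinB ltry. Qed.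

Lemma primitive_on_integrable f u x y : primitive_on G f u ->
  mu.-integrable `]x, y] (EFin \o f).
Proof.
move=> [mf _ f2 _]; apply: square_integrable_integrable => //.
by apply: bounded_itv_measure_lty.
Qed.

(** Integrate the weighted inequality [|f| <= eta / 2 * f ^ 2 + \1_G / (2 * eta)]. A free [eta] does
    the work of Cauchy-Schwarz: it first makes the energy term small, after which small increments
    of [s] handle the other. *)
Lemma primitive_on_increment_le f u (eta x y : R) : primitive_on G f u -> 0 < eta -> x <= y ->
  `|u y - u x| <= eta / 2 * \int[mu]_(t in `]x, y]) (f t ^+ 2) + (s y - s x) / (2 * eta).
Proof.
move=> P eta0 xy; have [mf f0 f2 uE] := P.
have fi := primitive_on_integrable x y P.
have mxy : measurable (`]x, y]%classic : set R) by exact: measurable_itv.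
have f2i : mu.-integrable `]x, y] (EFin \o (fun t => f t ^+ 2)) by exact: sqr_integrable.
have Gi : mu.-integrable `]x, y] (EFin \o (\1_G : R -> R)).
  have mI : measurable_fun setT (\1_G : R -> R) by exact: measurable_indic.
  by have [] := increment_abs_continuous ndS s_ac mI s_deriv xy.
pose h t := eta / 2 * f t ^+ 2 + (2 * eta)^-1 * \1_G t.
have h1i : mu.-integrable `]x, y] (EFin \o (fun t => eta / 2 * f t ^+ 2)).
  by apply: (integrableZl _ (eta / 2) f2i); exact: mxy.
have h2i : mu.-integrable `]x, y] (EFin \o (fun t => (2 * eta)^-1 * \1_G t)).
  by apply: (integrableZl _ (2 * eta)^-1 Gi); exact: mxy.
have hi : mu.-integrable `]x, y] (EFin \o h) by apply: (integrableD _ h1i h2i).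
have -> : eta / 2 * \int[mu]_(t in `]x, y]) (f t ^+ 2) + (s y - s x) / (2 * eta) =
    \int[mu]_(t in `]x, y]) h t.
  rewrite (RintegralD _ h1i h2i)// (RintegralZl _ _ f2i)// (RintegralZl _ _ Gi)//.
  by rewrite (scale_increment s_incr s_ac s_deriv G_open xy) [X in _ + X]mulrC.
rewrite uE//; apply: le_trans (le_normr_Rintegral _ fi) _; first exact: mxy.
apply: le_Rintegral => //; first exact: integrable_norm.
move=> t _; rewrite /h indicE; have [Gt|nGt] := pselect (G t); last first.
  by rewrite f0// normr0 memNset// expr0n/= !mulr0 addr0.
rewrite mem_set// mulr1 -[f t ^+ 2]real_normK ?num_real//.
have -> : (2 * eta)^-1 = eta^-1 / 2 by rewrite invfM mulrC.
have e1 : eta * eta^-1 = 1 by rewrite divff// gt_eqF.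
have ei : 0 < eta^-1 by rewrite invr_gt0.
have := mulr_ge0 (ltW ei) (sqr_ge0 (eta * `|f t| - 1)).
(* AM-GM: [2 z <= eta z^2 + eta^-1] *)
set z := `|f t|; have -> : eta^-1 * (eta * z - 1) ^+ 2 =
  (eta * eta^-1) * eta * z ^+ 2 - (eta * eta^-1) * 2 * z + eta^-1 by ring.
rewrite e1 !mul1r; lra.
Qed.

(** Disjointness makes the sum an integral over the union of the intervals, and the integrand is
    nonnegative. *)
Lemma sum_Rintegral_sqr_le (f : R -> R) n (x y : 'I_n -> R) : measurable_fun setT f ->
  (\int[mu]_x ((f x) ^+ 2)%:E < +oo)%E ->
  (forall i j, i != j -> y i <= x j \/ y j <= x i) ->
  \sum_(i < n) \int[mu]_(t in `]x i, y i]) (f t ^+ 2) <= \int[mu]_t (f t ^+ 2).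
Proof.
move=> mf f2 xy.
have mxy i : measurable (`]x i, y i]%classic : set R) by exact: measurable_itv.
have mf2 : measurable_fun setT (fun t => (f t ^+ 2)%:E).
  by apply/measurable_EFinP; exact: measurable_funX.
have f2T : mu.-integrable setT (EFin \o (fun t => f t ^+ 2)) by exact: sqr_integrable.
have f2i i : mu.-integrable `]x i, y i] (EFin \o (fun t => f t ^+ 2)) by exact: sqr_integrable.
rewrite -lee_fin -sumEFin /Rintegral fineK; last by apply: integrable_fin_num.
rewrite (eq_bigr (fun i => (\int[mu]_(t in `]x i, y i]) (f t ^+ 2)%:E)%E)); last first.
  by move=> i _; rewrite fineK//; apply: integrable_fin_num => //; exact: f2i.
rewrite -ge0_integral_bigsetU//=.
- apply: ge0_subset_integral => //.
  + by apply: bigsetU_measurable => i _; exact: mxy.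
  + by move=> t _; rewrite lee_fin sqr_ge0.
- exact: index_enum_uniq.
- apply/trivIsetP => i j _ _ ij; rewrite -subset0 => t []/=.
  rewrite !in_itv/= => /andP[xt ty] /andP[xt' ty'].
  case: (xy _ _ ij) => H.
    by have := le_lt_trans (le_trans ty H) xt'; rewrite ltxx.
  by have := le_lt_trans (le_trans ty' H) xt; rewrite ltxx.
- by apply: measurable_funTS.
- by move=> t _; rewrite lee_fin sqr_ge0.
Qed.

Lemma primitive_on_abs_cont_wrt f u : primitive_on G f u -> abs_cont_wrt s u.
Proof.
move=> P a b ab eps e0; have [mf f0 f2 uE] := P.
set K := \int[mu]_t (f t ^+ 2).
have K0 : 0 <= K by apply: Rintegral_ge0 => t _; exact: sqr_ge0.
(* Dividing by [K + 1] avoids the case [K = 0] and gives [eta * K < eps], so the energy terms sum to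
   less than [eps / 2]. The choice [delta = eps * eta] does the same for the scale terms. *)
pose eta := eps / (K + 1).
have eta0 : 0 < eta by rewrite divr_gt0// ltr_pwDr.
exists (eps * eta); split; first exact: mulr_gt0.
move=> n x y xyab xydisj sxy.
apply: (@le_lt_trans _ _ (\sum_(i < n) (eta / 2 * \int[mu]_(t in `]x i, y i]) (f t ^+ 2)
   + (s (y i) - s (x i)) / (2 * eta)))).
  apply: ler_sum => i _; have [_ [xyi _]] := xyab i.
  exact: primitive_on_increment_le.
rewrite big_split /= -mulr_sumr -mulr_suml.
have A := @sum_Rintegral_sqr_le f n x y mf f2 xydisj.
have B : \sum_(i < n) (s (y i) - s (x i)) < eps * eta.
  apply: le_lt_trans sxy; apply: ler_sum => i _; exact: ler_norm.
have etaK : eta * K < eps.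
  by rewrite /eta mulrAC ltr_pdivrMr ?ltr_pwDr// ltr_pM2l// ltrDl.
have C : (\sum_(i < n) (s (y i) - s (x i))) / (2 * eta) < eps / 2.
  have e2 : 0 < 2 * eta by rewrite mulr_gt0.
  rewrite ltr_pdivrMr//; apply: (lt_le_trans B).
  by rewrite (mulrA (eps / 2)) divfK.
have D : eta / 2 * \sum_(i < n) \int[mu]_(t in `]x i, y i]) (f t ^+ 2) <= eta / 2 * K.
  by apply: ler_wpM2l => //; rewrite ltW// divr_gt0.
clear -C D etaK; lra.
Qed.

(** The scale is nondecreasing and 1-Lipschitz, so its increments are bounded by the lengths of the
    intervals. *)
Lemma abs_cont_wrt_scale u : abs_cont_wrt s u -> abs_continuous u.
Proof.
move=> acu a b ab eps e0; have [d [d0 H]] := acu a b ab eps e0.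
exists d; split => // n x y xyab xydisj xyd; apply: H => //.
apply: le_lt_trans xyd; apply: ler_sum => i _; have [_ [xyi _]] := xyab i.
rewrite !ger0_norm ?subr_ge0//; last exact: ndS.
exact: (scale_lip s_incr s_ac s_deriv G_open).
Qed.

(** Lebesgue differentiation on bounded windows, where cutting [f] off makes it integrable on the
    line; countably many windows cover the line. *)
Lemma primitive_on_derive f u : primitive_on G f u ->
  {ae mu, forall x, derivable u x 1 /\ derive1 u x = f x}.
Proof.
move=> P; have [mf _ _ uE] := P.
suff main n : {ae mu, forall x, - n.+1%:R < x < n.+1%:R -> derivable u x 1 /\ derive1 u x = f x}.
  have := ae_foralln main; apply: filterS => x Hx.
  apply: (Hx (Num.truncn `|x|)); rewrite -ltr_norml; exact: truncnS_gt.
set a : R := - n.+1%:R; set b : R := n.+1%:R.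
have ab : a < b by rewrite /a /b gtrN.
pose g := f \_ `]a, b].
have gi : mu.-integrable setT (EFin \o g).
  rewrite /g -restrict_EFin; apply: (integrable_mkcond _ _).1; first exact: measurable_itv.
  exact: primitive_on_integrable P.
have uE' x : a <= x <= b -> u x = u a + \int[mu]_(t in `]a, x]) g t.
  move=> /andP[ax xb]; rewrite (_ : \int[mu]_(t in _) _ = u x - u a) ?subrKC//.
  rewrite uE//; apply: eq_Rintegral => t; rewrite inE/= in_itv/= => /andP[a_t tx].
  by rewrite /g patchE mem_set//= in_itv/= a_t (le_trans tx).
have := derivable_primitive ab gi uE'; apply: filterS => x Hx /andP[ax xb].
have [|? ->] := Hx; first by rewrite ax.
by split => //; rewrite /g patchE mem_set//= in_itv/= ax ltW.
Qed.
End primitives.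

(** * Limits of the scale and of primitives at the two ends, and the measure of [G] *)

Lemma nondecreasing_cvgy (R : realType) (s : R -> R) : {homo s : x y / x <= y} ->
  ~ (s x @[x --> +oo] --> +oo) ->
  exists l : R, s x @[x --> +oo] --> l /\ forall x, s x <= l.
Proof.
move=> nds; have [ub|nub] := pselect (has_ubound (range s)) => st.
  exists (sup (range s)); split; first exact: nondecreasing_cvgr.
  by move=> x; apply: ub_le_sup => //; exists x.
exfalso; apply: st; apply/cvgryPge => A.
have [x Ax] : exists x, A < s x.
  apply: contrapT => H; apply: nub; exists A => _ [x _ <-].
  by rewrite leNgt; apply/negP => ?; apply: H; exists x.
near=> y; apply: le_trans (ltW Ax) _; apply: nds.
by near: y; apply: nbhs_pinfty_ge; exact: num_real.
Unshelve. all: by end_near. Qed.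

Lemma nondecreasing_cvgNy (R : realType) (s : R -> R) : {homo s : x y / x <= y} ->
  ~ (s x @[x --> -oo] --> -oo) ->
  exists l : R, s x @[x --> -oo] --> l /\ forall x, l <= s x.
Proof.
move=> nds sb; pose h x := - s (- x).
have ndh : {homo h : x y / x <= y} by move=> x y xy; rewrite /h lerN2 nds// lerN2.
have [|l [hl lub]] := @nondecreasing_cvgy _ h ndh.
  move=> hoo; apply: sb; apply/cvgNy_compNP; apply/cvgNry.
  exact: hoo.
exists (- l); split.
  apply/cvgNy_compNP; rewrite (_ : s \o -%R = (fun x => - h x)).
    exact: cvgN.
  by apply/funext => x; rewrite /h /= opprK.
by move=> x; rewrite lerNl; have := lub (- x); rewrite /h opprK.
Qed.

Section limits.
Context (R : realType) (s : R -> R) (G : set R).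
Hypotheses (s_incr : forall x y : R, x < y -> s x < s y)
  (s_ac : abs_continuous s)
  (s_deriv : {ae @lebesgue_measure R, forall x,
                derivable s x 1 /\ derive1 s x = \1_G x})
  (G_open : open G).
Local Notation mu := (@lebesgue_measure R).
Let ndS := scale_homo s_incr.
Let mG : measurable G := measurable_G G_open.

(** Form of the increment estimate free of the order of [x] and [y], with the energy taken over the
    whole line so that its term depends on [eta] alone. *)
Lemma primitive_on_dist_le f u (eta x y : R) : primitive_on G f u -> 0 < eta ->
  `|u y - u x| <= eta / 2 * \int[mu]_t (f t ^+ 2) + `|s y - s x| / (2 * eta).
Proof.
move=> P eta0; wlog xy : x y / x <= y.
  by move=> W; have [/W//|/ltW/W] := leP x y; rewrite distrC (distrC (s x)).
apply: le_trans (primitive_on_increment_le s_incr s_ac s_deriv G_open P eta0 xy) _.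
rewrite ger0_norm ?subr_ge0 ?ndS// lerD2r ler_wpM2l//; first by rewrite ltW// divr_gt0.
have [mf _ f2 _] := P.
have f2T : mu.-integrable setT (EFin \o (fun t => f t ^+ 2)) by exact: sqr_integrable.
have f2xy : mu.-integrable `]x, y] (EFin \o (fun t => f t ^+ 2)).
  by apply: sqr_integrable => //; exact: measurable_itv.
rewrite -lee_fin /Rintegral !fineK; last 2 first.
- by apply: integrable_fin_num.
- by apply: integrable_fin_num => //; exact: measurable_itv.
apply: ge0_subset_integral => //.
- by apply/measurable_EFinP; exact: measurable_funX.
- by move=> t _; rewrite lee_fin sqr_ge0.
Qed.

(** Where the scale is within [e * eta / 2] of its limit, the distance estimate keeps values of [u]
    within [e]: the Cauchy criterion. A general filter serves both ends. *)
Lemma primitive_on_cvg f u (F : set_system R) {FF : ProperFilter F} (l : R) :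
  primitive_on G f u -> s x @[x --> F] --> l -> cvg (u x @[x --> F]).
Proof.
move=> P sl; apply: cauchy_cvg; apply: cauchy_exP => e e0.
set K := \int[mu]_t (f t ^+ 2).
have K0 : 0 <= K by apply: Rintegral_ge0 => t _; exact: sqr_ge0.
pose eta := e / (K + 1).
have eta0 : 0 < eta by rewrite divr_gt0// ltr_pwDr.
have ee0 : 0 < e * eta / 2 by rewrite divr_gt0// mulr_gt0.
have sle : \forall x \near F, `|l - s x| < e * eta / 2.
  by move/cvgrPdist_lt : sl; apply.
have [x0 x0l] := filter_ex sle.
exists (u x0); rewrite /= /nbhs /=; apply: filterS sle => x xl; rewrite /ball /=.
apply: le_lt_trans (primitive_on_dist_le x x0 P eta0) _.
have etaK : eta * K < e.
  by rewrite /eta mulrAC ltr_pdivrMr ?ltr_pwDr// ltr_pM2l// ltrDl.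
have B : `|s x0 - s x| < e * eta.
  rewrite -(subrKA l); apply: le_lt_trans (ler_normD _ _) _.
  rewrite distrC; have := ltrD x0l xl; rewrite -splitr; exact.
have C : `|s x0 - s x| / (2 * eta) < e / 2.
  have e2 : 0 < 2 * eta by rewrite mulr_gt0.
  rewrite ltr_pdivrMr//; apply: (lt_le_trans B).
  by rewrite (mulrA (e / 2)) divfK.
rewrite -/K; clear -C etaK; lra.
Qed.

(** The part of [G] in []-n, n]] has measure [s n - s (- n)], bounded by the difference of the
    limits of [s]; let [n] grow. *)
Lemma G_measure_lty : ~ s_bot_inf s -> ~ s_top_inf s -> (mu G < +oo)%E.
Proof.
move=> /(nondecreasing_cvgNy ndS)[m [_ ms]] /(nondecreasing_cvgy ndS)[M [_ sM]].
pose F n : set R := G `&` `](- n%:R), n%:R]%classic.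
have mF n : measurable (F n) by apply: measurableI => //; exact: measurable_itv.
have -> : G = \bigcup_n F n.
  apply/seteqP; split => [x Gx|x [n _ []]//].
  have := truncnS_gt `|x|; rewrite ltr_norml => /andP[xl xr].
  exists (Num.truncn `|x|).+1 => //; split => //=.
  by rewrite in_itv/= xl ltW.
have ndF : nondecreasing_seq F.
  move=> n k nk; apply/subsetPset; apply: setIS; apply: subset_itv.
    by rewrite bnd_simp lerN2 ler_nat.
  by rewrite bnd_simp ler_nat.
apply: (@le_lt_trans _ _ (M - m)%:E); last exact: ltry.
have cF := @nondecreasing_cvg_mu _ _ _ mu F mF (bigcupT_measurable _ mF) ndF.
rewrite -(cvg_lim _ cF)//; apply: lime_le; first by apply/cvg_ex; eexists; exact: cF.
apply: nearW => n /=; rewrite /F -(scale_measure s_incr s_ac s_deriv G_open); last first.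
  by rewrite ge0_cp.
by rewrite lee_fin lerB.
Qed.

(** For the converse of [G_measure_lty], the measure of [G] dominates every increment of [s], and
    these are unbounded when an end is infinite. *)
Lemma G_measure_pinfty : mu G = +oo%E <-> (s_bot_inf s \/ s_top_inf s).
Proof.
split=> [Goo|H].
  apply: contrapT => /not_orP[b t]; have := G_measure_lty b t.
  by rewrite Goo ltxx.
have le x y : x <= y -> ((s y - s x)%:E <= mu G)%E.
  move=> xy; rewrite (scale_measure s_incr s_ac s_deriv G_open xy).
  apply: le_measure; rewrite ?inE; last exact: subIsetl.
    by apply: measurableI; [exact: mG|exact: measurable_itv].
  exact: mG.
apply/eqyP => A A0; case: H.
  move=> /cvgrNyPle/(_ (s 0 - A)) => H.
  near -oo_R => x.
  have x0 : x <= 0 by near: x; apply: nbhs_ninfty_le; exact: num_real.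
  apply: le_trans (le _ _ x0); rewrite lee_fin lerBrDr -lerBrDl.
  by near: x.
move=> /cvgryPge/(_ (A + s 0)) => H.
near +oo_R => x.
have x0 : 0 <= x by near: x; apply: nbhs_pinfty_ge; exact: num_real.
apply: le_trans (le _ _ x0); rewrite lee_fin lerBrDr.
by near: x.
Unshelve. all: by end_near. Qed.

Lemma primitive_on_integrableT f u : primitive_on G f u -> (mu G < +oo)%E ->
  mu.-integrable setT (EFin \o f).
Proof.
move=> [mf f0 f2 _] Goo.
have := square_integrable_integrable mf f2 mG Goo.
move/(integrable_mkcond _ _).1; rewrite (_ : _ \_ G = EFin \o f); first by apply.
apply/funext => x; rewrite patchE; case: ifP => //.
by move/negbT; rewrite notin_setE => /f0 /= ->.
Qed.

(** The integral over []-n, n]] is [u n - u (- n)], which tends to 0; dominated convergence with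
    bound [|f|] identifies the limit as the full integral. *)
Lemma primitive_on_integral0 f u : primitive_on G f u -> (mu G < +oo)%E ->
  u x @[x --> +oo] --> (0 : R) -> u x @[x --> -oo] --> (0 : R) ->
  (\int[mu]_x (f x)%:E = 0)%E.
Proof.
move=> P Goo up um; have fT := primitive_on_integrableT P Goo.
have [mf f0 f2 uE] := P.
have mEf : measurable_fun setT (EFin \o f) by exact/measurable_EFinP.
pose A n : set R := `](- n%:R), n%:R]%classic.
pose fn n := (EFin \o f) \_ (A n).
have [|||||_ _ cv] := @dominated_convergence _ _ _ mu setT measurableT fn (EFin \o f)
   (abse \o (EFin \o f)).
- move=> n; apply: (measurable_restrictT _ _).1; first exact: measurable_itv.
  exact: measurable_funTS.
- by [].
- apply: aeW => x _; apply: cvg_near_cst; near=> n.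
  rewrite /fn patchE mem_set// /A /= in_itv/=.
  have : `|x| < n%:R.
    near: n; exists (Num.truncn `|x|).+1 => // k /= xk.
    by apply: lt_le_trans (truncnS_gt _) _; rewrite ler_nat.
  by rewrite ltr_norml => /andP[-> /ltW->].
- exact: integrable_abse.
- apply: aeW => x n _; rewrite /fn patchE; case: ifP => // _.
  by rewrite abse0 abse_ge0.
have cv' : (u n%:R - u (- n%:R))%:E @[n --> \oo] --> 0%E.
  rewrite (_ : 0%E = ((0 : R) - 0)%:E); last by rewrite subrr.
  apply: cvg_EFin; first exact: nearW.
  apply: cvgB.
    exact: (cvg_comp _ _ (@cvgr_idn R)).
  apply: (cvg_comp (fun n : nat => - (n%:R : R)) _ _ um).
  by apply/cvgNrNy; exact: cvgr_idn.
apply: (cvg_unique _ cv) => //; apply: cvg_trans cv'; apply: near_eq_cvg; apply: nearW => n.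
rewrite /= /fn -integral_mkcond uE ?ge0_cp// /Rintegral fineK//.
apply: integrable_fin_num; first exact: measurable_itv.
exact: primitive_on_integrable P.
Unshelve. all: by end_near. Qed.

End limits.

(** * Existence of primitives *)

Section primitive_exists.
Context (R : realType).
Local Notation mu := (@lebesgue_measure R).

Lemma Rintegral_itv_chasles (f : R -> R) (x y z : R) : x <= y -> y <= z ->
  mu.-integrable `]x, z] (EFin \o f) ->
  \int[mu]_(t in `]x, z]) f t = \int[mu]_(t in `]x, y]) f t + \int[mu]_(t in `]y, z]) f t.
Proof.
move=> xy yz fi.
have E : `]x, z]%classic = `]x, y] `|` `]y, z] :> set R.
  by rewrite -itv_bndbnd_setU ?bnd_simp.
rewrite {1}E Rintegral_setU//; try exact: measurable_itv.
  by rewrite -E.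
apply/disj_setPLR => t /=; rewrite !in_itv/= => /andP[_ ty]; apply/negP.
by rewrite negb_and -leNgt ty.
Qed.

Lemma primitive_on_exists (G : set R) (f : R -> R) : measurable_fun setT f ->
  (forall x, ~ G x -> f x = 0) -> (\int[mu]_x ((f x) ^+ 2)%:E < +oo)%E ->
  exists u, primitive_on G f u.
Proof.
move=> mf f0 f2.
pose I x y := \int[mu]_(t in `]x, y]) f t.
have ch x y z : x <= y -> y <= z -> I x z = I x y + I y z.
  move=> xy yz; apply: Rintegral_itv_chasles => //.
  apply: square_integrable_integrable => //.
  by apply: bounded_itv_measure_lty.
have I0 x : I x x = 0 by rewrite /I set_itv_ge ?bnd_simp ?ltxx// Rintegral_set0.
(* The primitive vanishing at 0, written as an oriented integral. *)
exists (fun x => if 0 <= x then I 0 x else - I x 0); split => // x y xy.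
rewrite -/(I x y); case: (leP 0 x) => x0.
  by rewrite (le_trans x0 xy) (ch 0 x y)// addrC addKr.
case: (leP 0 y) => y0; first by rewrite (ch x 0 y) ?(ltW x0)// opprK addrC.
by rewrite (ch x y 0)// ?(ltW y0)//; lra.
Qed.
End primitive_exists.

(** * Differences and shifts of square-integrable functions and primitives *)

Section algebra.
Context (R : realType).
Local Notation mu := (@lebesgue_measure R).

Lemma integrable_sqr_lty (f : R -> R) : mu.-integrable setT (EFin \o (fun x => f x ^+ 2)) ->
  (\int[mu]_x ((f x) ^+ 2)%:E < +oo)%E.
Proof.
move=> /integrableP[_]; apply: le_lt_trans; rewrite le_eqVlt; apply/orP; left; apply/eqP.
by apply: eq_integral => x _ /=; rewrite ger0_norm// sqr_ge0.
Qed.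

Lemma le_sqr_integral_lty (f g : R -> R) : measurable_fun setT f ->
  mu.-integrable setT (EFin \o g) -> (forall x, f x ^+ 2 <= g x) ->
  (\int[mu]_x ((f x) ^+ 2)%:E < +oo)%E.
Proof.
move=> mf gi fg; apply: integrable_sqr_lty; apply: (le_integrable _ _ _ gi) => //.
  by apply/measurable_EFinP; exact: measurable_funX.
move=> x _ /=; rewrite lee_fin !ger0_norm ?sqr_ge0//.
by apply: le_trans (fg x); exact: sqr_ge0.
Qed.

Lemma sqr_integralB_lty (f g : R -> R) : measurable_fun setT f -> measurable_fun setT g ->
  (\int[mu]_x ((f x) ^+ 2)%:E < +oo)%E -> (\int[mu]_x ((g x) ^+ 2)%:E < +oo)%E ->
  (\int[mu]_x ((f x - g x) ^+ 2)%:E < +oo)%E.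
Proof.
move=> mf mg f2 g2.
have fi : mu.-integrable setT (EFin \o (fun x => f x ^+ 2)) by exact: sqr_integrable.
have gi : mu.-integrable setT (EFin \o (fun x => g x ^+ 2)) by exact: sqr_integrable.
have hi : mu.-integrable setT (EFin \o (fun x => 2 * f x ^+ 2 + 2 * g x ^+ 2)).
  have := integrableD measurableT (integrableZl measurableT 2 fi) (integrableZl measurableT 2 gi).
  by apply.
apply: le_sqr_integral_lty hi _; first exact: measurable_funB.
by move=> x; have := sqr_ge0 (f x + g x); nra.
Qed.

Lemma primitive_on_shift (G : set R) f u k : primitive_on G f u ->
  primitive_on G f (fun x => u x + k).
Proof. by move=> [mf f0 f2 uE]; split => // x y xy; rewrite -uE//; lra. Qed.

Lemma primitive_onB (G : set R) f g u v : primitive_on G f u -> primitive_on G g v ->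
  primitive_on G (fun x => f x - g x) (fun x => u x - v x).
Proof.
move=> P Q; have [mf f0 f2 uE] := P; have [mg g0 g2 vE] := Q; split.
- exact: measurable_funB.
- by move=> x nG; rewrite f0// g0// subrr.
- exact: sqr_integralB_lty.
- move=> x y xy; rewrite RintegralB//.
  + by rewrite -uE// -vE//; lra.
  + exact: primitive_on_integrable P.
  + exact: primitive_on_integrable Q.
Qed.

End algebra.

(** Checks the end conditions of the corrected primitive [U - c * s + k]. Stating [k] through an
    equation lets the same constant serve both ends. *)
Lemma cvg_affine (R : realType) (F : set_system R) {FF : Filter F} (u s : R -> R)
    (l m c k : R) : u x @[x --> F] --> l -> s x @[x --> F] --> m -> k = c * m - l ->
  u x - c * s x + k @[x --> F] --> (0 : R).
Proof.
move=> ul sm kE; rewrite (_ : 0 = l - c * m + k); last by rewrite kE; lra.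
by apply: cvgD; [apply: cvgB => //; apply: cvgM => //; exact: cvg_cst|exact: cvg_cst].
Qed.

(** * Orthogonality to the subspace, and the decomposition *)

Section decomposition.
Context (R : realType) (s : R -> R) (G : set R).
Hypotheses (s_incr : forall x y : R, x < y -> s x < s y)
  (s_ac : abs_continuous s)
  (s_deriv : {ae @lebesgue_measure R, forall x,
                derivable s x 1 /\ derive1 s x = \1_G x})
  (G_open : open G).
Local Notation mu := (@lebesgue_measure R).
Let ndS := scale_homo s_incr.
Let mG : measurable G := measurable_G G_open.

Definition vanishes_at_finite_ends (u : R -> R) : Prop :=
  (~ s_top_inf s -> u x @[x --> +oo] --> (0 : R)) /\
  (~ s_bot_inf s -> u x @[x --> -oo] --> (0 : R)).

(** Moves membership in [Fs_e] to Lebesgue terms; absolute continuity with respect to [s] is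
    recovered from the increment estimate. *)
Lemma Fs_e_primitive u : Fs_e s u <->
  exists2 f, primitive_on G f u & vanishes_at_finite_ends u.
Proof.
split=> [[_ [[f [uf f2]] v]]|[f P v]].
  exists (f \_ G) => //; exact: (primitive_on_of_dds s_incr s_ac s_deriv G_open).
split; first exact: (primitive_on_abs_cont_wrt s_incr s_ac s_deriv G_open P).
split => //; exists f; exact: (dds_of_primitive_on s_incr s_ac s_deriv G_open).
Qed.

Lemma primitive_on_abs_continuous f u : primitive_on G f u -> abs_continuous u.
Proof.
move=> P; apply: (abs_cont_wrt_scale s_incr s_ac s_deriv G_open).
exact: (primitive_on_abs_cont_wrt s_incr s_ac s_deriv G_open P).
Qed.

Lemma primitive_on_is_derive f u : primitive_on G f u ->
  {ae mu, forall x : R, is_derive x 1 u (f x)}.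
Proof.
by move=> /primitive_on_derive; apply: filterS => x [D <-]; rewrite derive1E; exact: DeriveDef.
Qed.

Lemma dderiv_primitive_on f u : primitive_on G f u -> {ae mu, forall x, dderiv u x = f x}.
Proof. by move=> /primitive_on_is_derive; apply: filterS => x; exact: dderivE. Qed.

(** Multiples of [s] are the correction terms when both ends are finite; finiteness of the measure
    of [G] puts [\1_G] in [L^2]. *)
Lemma scale_primitive_on c : (mu G < +oo)%E ->
  primitive_on G (fun x => c * \1_G x) (fun x => c * s x).
Proof.
move=> Goo; have mI : measurable_fun setT (\1_G : R -> R) by exact: measurable_indic.
have Gi : mu.-integrable setT (EFin \o (\1_G : R -> R)).
  apply/integrableP; split; first exact/measurable_EFinP.
  rewrite (_ : (\int[mu]_x _)%E = mu G)//.
  rewrite -[in RHS](setIT G) -integral_indic//.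
  by apply: eq_integral => x _ /=; rewrite ger0_norm.
split.
- exact: measurable_funM.
- by move=> x nG; rewrite indicE memNset// mulr0.
- apply: (@le_sqr_integral_lty _ _ (fun x => c ^+ 2 * \1_G x)).
  + exact: measurable_funM.
  + by apply: (integrableZl _ (c ^+ 2) Gi).
  + move=> x; rewrite exprMn indicE; case: (x \in G); rewrite ?expr1n//.
    by rewrite expr0n.
- move=> x y xy; have [GI sE] := increment_abs_continuous ndS s_ac mI s_deriv xy.
  by rewrite (RintegralZl _ _ GI)// -mulrBr sE.
Qed.

(** For [d = u'] this yields the component of [u] in [Fs_e], and also the test function that forces
    [u'] to be constant on [G]. *)
Lemma exists_primitive_shift (d : R -> R) : measurable_fun setT d ->
  (\int[mu]_x ((d x) ^+ 2)%:E < +oo)%E ->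
  exists c f u, [/\ primitive_on G f u, vanishes_at_finite_ends u,
    forall x, G x -> f x = d x - c & mu G = +oo%E -> c = 0].
Proof.
move=> md d2; pose f := d \_ G.
have mf : measurable_fun setT f by exact: patch_measurable.
have f0 x : ~ G x -> f x = 0 by move=> nG; rewrite /f patchE memNset.
have fG x : G x -> f x = d x by move=> Gx; rewrite /f patchE mem_set.
have f2 : (\int[mu]_x ((f x) ^+ 2)%:E < +oo)%E.
  apply: (@le_sqr_integral_lty _ _ (fun x => d x ^+ 2)) => //.
    exact: sqr_integrable.
  move=> x; have [Gx|nG] := pselect (G x); first by rewrite fG.
  by rewrite f0// expr0n/= sqr_ge0.
have [U PU] := primitive_on_exists mf f0 f2.
have cU (F : set_system R) (FF : ProperFilter F) (l : R) : s x @[x --> F] --> l ->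
    exists L : R, U x @[x --> F] --> L.
  move=> sl; exists (lim (U x @[x --> F])).
  exact: (primitive_on_cvg s_incr s_ac s_deriv G_open PU sl).
(* With at most one finite end, [c = 0] and subtracting the limit of [U] at that end suffices. *)
have [top|ntop] := pselect (s_top_inf s); have [bot|nbot] := pselect (s_bot_inf s).
- by exists 0, f, U; split => // x Gx; rewrite fG// subr0.
- have [l [sl _]] := nondecreasing_cvgNy ndS nbot.
  have [L UL] := cU _ _ _ sl.
  exists 0, f, (fun x => U x + - L); split => //; first exact: primitive_on_shift.
    split => // _; rewrite -(subrr L); apply: cvgD => //; exact: cvg_cst.
  by move=> x Gx; rewrite fG// subr0.
- have [l [sl _]] := nondecreasing_cvgy ndS ntop.
  have [L UL] := cU _ _ _ sl.
  exists 0, f, (fun x => U x + - L); split => //; first exact: primitive_on_shift.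
    split => // _; rewrite -(subrr L); apply: cvgD => //; exact: cvg_cst.
  by move=> x Gx; rewrite fG// subr0.
have Goo := G_measure_lty s_incr s_ac s_deriv G_open nbot ntop.
have [m [sm ms]] := nondecreasing_cvgNy ndS nbot.
have [M [sM Ms]] := nondecreasing_cvgy ndS ntop.
have mM : m < M.
  by apply: le_lt_trans (ms 0) _; apply: lt_le_trans (Ms 1); exact: s_incr.
have [Lm Um] := cU _ _ _ sm.
have [LM UM] := cU _ _ _ sM.
(* With two finite ends, a constant alone cannot cancel two different limits. This [c], the mean of
   [d] over [G], gives [U - c * s] the same limit at both ends, which the constant [c * M - LM] then
   cancels. *)
pose c := (LM - Lm) / (M - m).
have cE : c * (M - m) = LM - Lm by rewrite /c divfK// subr_eq0 gt_eqF.
exists c, (fun x => f x - c * \1_G x), (fun x => U x - c * s x + (c * M - LM)); split.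
- by apply: primitive_on_shift; apply: primitive_onB => //; exact: scale_primitive_on.
- by split=> _; [apply: cvg_affine UM sM _|apply: cvg_affine Um sm _; lra].
- by move=> x Gx; rewrite fG// indicE mem_set// mulr1.
- by move=> GE; rewrite GE ltxx in Goo.
Qed.

(** A nonzero constant is not square-integrable over a set of infinite measure. *)
Lemma const_eq0_of_infinite u c : Fe u ->
  {ae mu, forall x, G x -> dderiv u x = c} -> mu G = +oo%E -> c = 0.
Proof.
move=> [_ [md d2]] dc GE; apply/eqP/negPn/negP => c0.
move: d2; rewrite ltNge => /negP; apply.
rewrite (_ : +oo%E = (\int[mu]_(x in G) (c ^+ 2)%:E)%E); last first.
  have -> : (\int[mu]_(x in G) (c ^+ 2)%:E = (c ^+ 2)%:E * mu G)%E by exact: integral_cst.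
  by rewrite GE gt0_muley// lte_fin exprn_even_gt0.
have md2 : measurable_fun setT (fun x => (dderiv u x ^+ 2)%:E).
  by apply/measurable_EFinP; exact: measurable_funX.
apply: (@le_trans _ _ (\int[mu]_(x in G) (dderiv u x ^+ 2)%:E)%E).
  rewrite le_eqVlt; apply/orP; left; apply/eqP; apply: ae_eq_integral => //.
    exact: measurable_funTS.
  by move: dc; apply: filterS => x H Gx; rewrite H.
apply: ge0_subset_integral => //.
by move=> x _; rewrite lee_fin sqr_ge0.
Qed.

(** Either [c = 0], or [G] has finite measure, both ends are finite and [u] vanishes at both, so [f]
    has integral 0. *)
Lemma primitive_on_integral_scale0 f u c : primitive_on G f u ->
  vanishes_at_finite_ends u -> (mu G = +oo%E -> c = 0) ->
  mu.-integrable setT (EFin \o (fun x => c * f x)) /\ (\int[mu]_x (c * f x)%:E = 0)%E.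
Proof.
move=> P [vt vb] c0; have [GE|Gfin] := eqVneq (mu G) +oo%E.
  rewrite c0//; split; last by apply: integral0_eq => x _; rewrite mul0r.
  rewrite (_ : EFin \o _ = cst 0%E); first exact: integrable0.
  by apply/funext => x /=; rewrite mul0r.
have Goo : (mu G < +oo)%E by rewrite ltey.
have fi := primitive_on_integrableT G_open P Goo.
have [nb nt] : ~ s_bot_inf s /\ ~ s_top_inf s.
  apply/not_orP => H; move/eqP: Gfin; apply.
  exact/(G_measure_pinfty s_incr s_ac s_deriv G_open).
split; first by apply: (integrableZl _ c fi).
under eq_integral do rewrite EFinM.
rewrite integralZl// (primitive_on_integral0 G_open P Goo (vt nt) (vb nb)).
by rewrite mule0.
Qed.

Lemma integral_dderiv_primitive u f v : Fe u -> primitive_on G f v ->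
  (\int[mu]_x (dderiv u x * dderiv v x)%:E = \int[mu]_x (dderiv u x * f x)%:E)%E.
Proof.
move=> [_ [md _]] P; have [mf _ _ _] := P.
have mv : measurable_fun setT (dderiv v).
  apply: measurable_dderiv; apply: abs_continuous_continuous.
  exact: primitive_on_abs_continuous P.
apply: ae_eq_integral => //.
- by apply/measurable_EFinP; exact: measurable_funM.
- by apply/measurable_EFinP; exact: measurable_funM.
- by have := dderiv_primitive_on P; apply: filterS => x H _; rewrite H.
Qed.

(** Since [f] vanishes off [G], the product [u' f] is almost everywhere [c * f], whose integral is
    0. *)
Lemma Gs_of_const u c : Fe u ->
  {ae mu, forall x, G x -> dderiv u x = c} -> Gs s u.
Proof.
move=> Fu dc; split => // v /Fs_e_primitive[f P vv]; have [mf f0 _ _] := P.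
have c0 := const_eq0_of_infinite Fu dc.
rewrite /Eform (integral_dderiv_primitive Fu P).
have [_ <-] := primitive_on_integral_scale0 P vv c0.
rewrite (_ : (\int[mu]_x (dderiv u x * f x)%:E = \int[mu]_x (c * f x)%:E)%E).
  by have [_ ->] := primitive_on_integral_scale0 P vv c0; rewrite mule0.
have [_ [md _]] := Fu; apply: ae_eq_integral => //.
- by apply/measurable_EFinP; exact: measurable_funM.
- by apply/measurable_EFinP; exact: measurable_funM.
- move: dc; apply: filterS => x H _.
  by have [/H->//|/f0->] := pselect (G x); rewrite !mulr0.
Qed.

Lemma const_of_Gs u : Gs s u -> exists c, {ae mu, forall x, G x -> dderiv u x = c}.
Proof.
move=> [Fu orth]; have [_ [md d2]] := Fu.
(* The test function is the primitive built from [u'] itself. *)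
have [c [f [v [P vv fG c0]]]] := exists_primitive_shift md d2.
have [mf f0 f2 _] := P.
have Fv : Fs_e s v by apply/Fs_e_primitive; exists f.
have := orth _ Fv; rewrite /Eform (integral_dderiv_primitive Fu P) => /eqP.
rewrite mule_eq0 eqe invr_eq0 pnatr_eq0/= => /eqP E.
have [ci I0] := primitive_on_integral_scale0 P vv c0.
have f2i : mu.-integrable setT (EFin \o (fun x => f x ^+ 2)) by exact: sqr_integrable.
have E2 : (\int[mu]_x (f x ^+ 2)%:E = 0)%E.
  (* Adding the null integral of [c * f] turns [f ^ 2] into [u' f]: on [G] because [u' = f + c], off
     [G] because [f = 0]. *)
  rewrite -E -[LHS]adde0 -I0 -integralD//; apply: eq_integral => x _.
  rewrite -EFinD; congr EFin; have [Gx|nG] := pselect (G x).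
    by rewrite fG//; ring.
  by rewrite f0//; ring.
exists c; have /integrableP[mf2 _] := f2i.
have : ae_eq mu setT (EFin \o (fun x => f x ^+ 2)) (cst 0%E).
  apply/(ae_eq_integral_abs mu measurableT mf2); rewrite -[RHS]E2.
  by apply: eq_integral => x _ /=; rewrite ger0_norm// sqr_ge0.
apply: filterS => x H Gx; have := H Logic.I => -[] /eqP.
by rewrite sqrf_eq0 fG// subr_eq0 => /eqP.
Qed.

Lemma Fe_decomposition u : Fe u ->
  exists u1 u2, Fs_e s u1 /\ Gs s u2 /\ forall x, u x = u1 x + u2 x.
Proof.
move=> Fu; have [acu [md d2]] := Fu.
have [c [f [v [P vv fG c0]]]] := exists_primitive_shift md d2.
have [mf f0 f2 _] := P.
have acv := primitive_on_abs_continuous P.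
exists v, (fun x => u x - v x); split; first by apply/Fs_e_primitive; exists f.
split; last by move=> x; rewrite addrC subrK.
have acw : abs_continuous (fun x => u x - v x) by exact: abs_continuousB.
(* The derivatives subtract where both functions are differentiable; for [u] this holds almost
   everywhere by [abs_continuous_derivable]. *)
have dw : {ae mu, forall x, dderiv (fun x => u x - v x) x = dderiv u x - f x}.
  have := primitive_on_is_derive P; have := abs_continuous_derivable acu.
  apply: filterS2 => x /dderivP Du Dv.
  exact: (dderivE (is_deriveB Du Dv)).
have mdw : measurable_fun setT (dderiv (fun x => u x - v x)).
  by apply: measurable_dderiv; exact: abs_continuous_continuous.
apply: (@Gs_of_const _ c).
  split; [exact: acw|split; [exact: mdw|]].
  rewrite (_ : (\int[mu]_x _)%E = (\int[mu]_x ((dderiv u x - f x) ^+ 2)%:E)%E).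
    exact: sqr_integralB_lty.
  apply: ae_eq_integral => //.
  - by apply/measurable_EFinP; exact: measurable_funX.
  - by apply/measurable_EFinP; apply: measurable_funX; exact: measurable_funB.
  - by move: dw; apply: filterS => x H _; rewrite H.
by move: dw; apply: filterS => x H Gx; rewrite H fG//; lra.
Qed.

(** The difference [u1 - w1 = w2 - u2] is a primitive with density zero off [G] and the constant
    [cw - cu] on [G], hence an affine function of [s]. *)
Lemma decomposition_difference u1 u2 w1 w2 : Fs_e s u1 -> Gs s u2 -> Fs_e s w1 -> Gs s w2 ->
  (forall x, u1 x + u2 x = w1 x + w2 x) ->
  exists k, (mu G = +oo%E -> k = 0) /\
    (forall x, u1 x - w1 x = k * s x + (u1 0 - w1 0 - k * s 0)).
Proof.
move=> /Fs_e_primitive[f P _] Gu /Fs_e_primitive[h Q _] Gw E.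
have [cu du] := const_of_Gs Gu; have [cw dw] := const_of_Gs Gw.
have [[acu [_ _]] _] := Gu; have [[acw [_ _]] _] := Gw.
have PQ := primitive_onB P Q; have [mfh fh0 fh2 zE] := PQ.
exists (cw - cu); split.
  move=> GE; rewrite (const_eq0_of_infinite Gu.1 du GE).
  by rewrite (const_eq0_of_infinite Gw.1 dw GE) subrr.
have fhE : {ae mu, forall x, f x - h x = (cw - cu) * \1_G x}.
  have A : {ae mu, forall x, f x - h x = dderiv w2 x - dderiv u2 x}.
    have D1 : {ae mu, forall x : R, is_derive x 1 (u1 + u2) (f x + dderiv u2 x)}.
      have := abs_continuous_derivable acu; have := primitive_on_is_derive P.
      by apply: filterS2 => x D /dderivP D'; exact: (is_deriveD D D').
    have D2 : {ae mu, forall x : R, is_derive x 1 (u1 + u2) (h x + dderiv w2 x)}.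
      rewrite (_ : u1 + u2 = w1 + w2); last by apply/funext => t; exact: E.
      have := abs_continuous_derivable acw; have := primitive_on_is_derive Q.
      by apply: filterS2 => x D /dderivP D'; exact: (is_deriveD D D').
    move: D1 D2; apply: filterS2 => x /dderivE D1 /dderivE.
    by rewrite D1; lra.
  have B : {ae mu, forall x, G x -> dderiv w2 x - dderiv u2 x = cw - cu}.
    by move: dw du; apply: filterS2 => x W U Gx; rewrite W// U.
  move: A B; apply: filterS2 => x A B; have [Gx|nG] := pselect (G x).
    by rewrite A B// indicE mem_set// mulr1.
  by rewrite fh0// indicE memNset// mulr0.
have zs x y : x <= y -> u1 y - w1 y - (u1 x - w1 x) = (cw - cu) * (s y - s x).
  move=> xy; rewrite zE//.
  have mI : measurable_fun setT (\1_G : R -> R) by exact: measurable_indic.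
  have [GI sE] := increment_abs_continuous ndS s_ac mI s_deriv xy.
  rewrite sE -(RintegralZl _ _ GI)// /Rintegral; congr fine.
  apply: ae_eq_integral => //.
  - by apply: measurable_funTS; exact/measurable_EFinP.
  - by apply: measurable_funTS; apply/measurable_EFinP; exact: measurable_funM.
  - by move: fhE; apply: filterS => t H _; rewrite H.
move=> x; have [x0|/ltW x0] := leP 0 x; have := zs _ _ x0; lra.
Qed.

(** The difference [k * s + b] tends to 0 at each finite end. If [G] has infinite measure then
    [k = 0], and one finite end gives [b = 0]; otherwise the two distinct limits of [s] give
    [k = b = 0]. *)
Lemma decomposition_unique_transient u1 u2 w1 w2 : s_transient s ->
  Fs_e s u1 -> Gs s u2 -> Fs_e s w1 -> Gs s w2 ->
  (forall x, u1 x + u2 x = w1 x + w2 x) ->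
  (forall x, u1 x = w1 x) /\ (forall x, u2 x = w2 x).
Proof.
move=> tr F1 G2 F1' G2' E; have [k [k0 zE]] := decomposition_difference F1 G2 F1' G2' E.
pose b := u1 0 - w1 0 - k * s 0.
have {}zE x : u1 x - w1 x = k * s x + b by exact: zE.
have [_ [_ [tu bu]]] := F1; have [_ [_ [tw bw]]] := F1'.
have lim (F : set_system R) (FF : ProperFilter F) (l : R) : s x @[x --> F] --> l ->
    u1 x @[x --> F] --> (0 : R) -> w1 x @[x --> F] --> (0 : R) -> k * l + b = 0.
  move=> sl ul wl; apply: (@cvg_unique _ _ (k * s x + b @[x --> F])).
  - exact: Rhausdorff.
  - by apply: cvgD; [apply: cvgM => //; exact: cvg_cst|exact: cvg_cst].
  - rewrite (_ : (fun x => k * s x + b) = (fun x => u1 x - w1 x)).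
      by rewrite -(subrr 0); exact: cvgB.
    by apply/funext => x; rewrite zE.
have kb : k = 0 /\ b = 0.
  have [GE|Gfin] := eqVneq (mu G) +oo%E.
    have {}k0 := k0 GE; split => //; case: tr => H.
      have [l [sl _]] := nondecreasing_cvgNy ndS H.
      by have := lim _ _ _ sl (bu H) (bw H); rewrite k0 mul0r add0r; apply.
    have [l [sl _]] := nondecreasing_cvgy ndS H.
    by have := lim _ _ _ sl (tu H) (tw H); rewrite k0 mul0r add0r; apply.
  have [nb nt] : ~ s_bot_inf s /\ ~ s_top_inf s.
    apply/not_orP => H; move/eqP: Gfin; apply.
    exact/(G_measure_pinfty s_incr s_ac s_deriv G_open).
  have [m [sm ms]] := nondecreasing_cvgNy ndS nb.
  have [M [sM Ms]] := nondecreasing_cvgy ndS nt.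
  have mM : m < M.
    by apply: le_lt_trans (ms 0) _; apply: lt_le_trans (Ms 1); exact: s_incr.
  have A := lim _ _ _ sm (bu nb) (bw nb); have B := lim _ _ _ sM (tu nt) (tw nt).
  have /eqP : k * (M - m) = 0.
    have -> : k * (M - m) = (k * M + b) - (k * m + b) by ring.
    by rewrite A B subrr.
  rewrite mulf_eq0 subr_eq0 (gt_eqF mM) orbF => /eqP k0'.
  by split => //; move: A; rewrite k0' mul0r add0r; apply.
have z0 x : u1 x = w1 x.
  by apply/eqP; rewrite -subr_eq0 zE kb.1 kb.2 mul0r addr0.
by split => // x; have := E x; rewrite z0 => /addrI.
Qed.

(** Infinite ends give [G] infinite measure, so [k = 0] and the difference is its value at 0. *)
Lemma decomposition_unique_recurrent u1 u2 w1 w2 : s_recurrent s ->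
  Fs_e s u1 -> Gs s u2 -> Fs_e s w1 -> Gs s w2 ->
  (forall x, u1 x + u2 x = w1 x + w2 x) ->
  exists c : R, (forall x, u1 x = w1 x + c) /\ (forall x, u2 x = w2 x - c).
Proof.
move=> [bot _] F1 G2 F1' G2' E; have [k [k0 zE]] := decomposition_difference F1 G2 F1' G2' E.
have GE : mu G = +oo%E.
  by apply/(G_measure_pinfty s_incr s_ac s_deriv G_open); left.
rewrite (k0 GE) in zE.
exists (u1 0 - w1 0); split => x; have := zE x; have := E x; lra.
Qed.

End decomposition.

(** * Description of the complement, existence and uniqueness of the decomposition *)

Theorem mainTheorem8 (R : realType) (s : R -> R) (G : set R)
  (s_incr : forall x y : R, x < y -> s x < s y)
  (s_ac : abs_continuous s)
  (s_deriv : {ae @lebesgue_measure R, forall x,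
                derivable s x 1 /\ derive1 s x = \1_G x})
  (G_open : open G)
  (F_pos : (0 < @lebesgue_measure R (~` G))%E)
  (F_noiso : forall x, (~` G) x -> forall e : R, 0 < e ->
               exists y, y != x /\ `|y - x| < e /\ (~` G) y) :
  (* description of G^(s) *)
  (forall u, Gs s u <->
     Fe u /\ exists c : R, {ae @lebesgue_measure R, forall x, G x -> dderiv u x = c})
  (* m(G) = oo  iff  s(-oo) = -oo or s(oo) = oo *)
  /\ (@lebesgue_measure R G = +oo%E <-> (s_bot_inf s \/ s_top_inf s))
  (* the case m(G) = oo *)
  /\ (@lebesgue_measure R G = +oo%E -> forall u, Gs s u <->
       Fe u /\ {ae @lebesgue_measure R, forall x, G x -> dderiv u x = 0})
  (* existence of the decomposition *)
  /\ (forall u, Fe u -> exists u1 u2, Fs_e s u1 /\ Gs s u2 /\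
        forall x, u x = u1 x + u2 x)
  (* uniqueness in the transient case *)
  /\ (s_transient s -> forall u1 u2 w1 w2,
        Fs_e s u1 -> Gs s u2 -> Fs_e s w1 -> Gs s w2 ->
        (forall x, u1 x + u2 x = w1 x + w2 x) ->
        (forall x, u1 x = w1 x) /\ (forall x, u2 x = w2 x))
  (* uniqueness up to an additive constant in the recurrent case *)
  /\ (s_recurrent s -> forall u1 u2 w1 w2,
        Fs_e s u1 -> Gs s u2 -> Fs_e s w1 -> Gs s w2 ->
        (forall x, u1 x + u2 x = w1 x + w2 x) ->
        exists c : R, (forall x, u1 x = w1 x + c) /\ (forall x, u2 x = w2 x - c)).
Proof.
split; [|split; [|split; [|split; [|split]]]].
- move=> u; split=> [Gu|[Fu [c uc]]]; last exact: (Gs_of_const s_incr s_ac s_deriv G_open Fu uc).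
  by split; [exact: Gu.1|exact: (const_of_Gs s_incr s_ac s_deriv G_open Gu)].
- exact: (G_measure_pinfty s_incr s_ac s_deriv G_open).
- move=> GE u; split=> [Gu|[Fu uc]]; last exact: (Gs_of_const s_incr s_ac s_deriv G_open Fu uc).
  have [c uc] := const_of_Gs s_incr s_ac s_deriv G_open Gu.
  by split; [exact: Gu.1|rewrite -(const_eq0_of_infinite G_open Gu.1 uc GE)].
- move=> u; exact: (Fe_decomposition s_incr s_ac s_deriv G_open).
- move=> tr u1 u2 w1 w2.
  exact: (decomposition_unique_transient s_incr s_ac s_deriv G_open tr).
- move=> re u1 u2 w1 w2.
  exact: (decomposition_unique_recurrent s_incr s_ac s_deriv G_open re).
Qed.
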